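(* Let $\mathfrak m=\bigoplus_{p<0}\mathfrak g_p$ be a free pseudo-product fundamental graded Lie algebra of type $(m,n,\mu)$ with pseudo-product structure $(\mathfrak e,\mathfrak f)$ over $\mathbb C$, and let $\mathfrak g=\bigoplus_{p\in\mathbb Z}\mathfrak g_p$ be the prolongation of $(\mathfrak m;\mathfrak e,\mathfrak f)$. The mapping $$\Phi:\operatorname{Aut}(\mathfrak g;\mathfrak e,\mathfrak f)_0\ni\phi\mapsto(\phi|\mathfrak e,\phi|\mathfrak f)\in GL(\mathfrak e)\times GL(\mathfrak f)$$ is an isomorphism (of groups). Furthermore, if $\dim\mathfrak e\neq\dim\mathfrak f$, then $\operatorname{Aut}(\mathfrak g;\mathfrak e,\mathfrak f)_0=\operatorname{Aut}(\mathfrak g)_0$.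
   Context: All vector spaces are over $\mathbb C$. A graded Lie algebra (GLA) is a Lie algebra $\mathfrak g=\bigoplus_{p\in\mathbb Z}\mathfrak g_p$ with $\dim\mathfrak g_p<\infty$ and $[\mathfrak g_p,\mathfrak g_q]\subset\mathfrak g_{p+q}$; $\mathfrak g_-=\bigoplus_{p<0}\mathfrak g_p$. It is transitive if for $p\ge 0$ and $X\in\mathfrak g_p$, $[X,\mathfrak g_-]=\{0\}$ implies $X=0$. A fundamental graded Lie algebra (FGLA) is a finite-dimensional GLA $\mathfrak m=\bigoplus_{p<0}\mathfrak g_p$ with $\mathfrak g_{-1}\ne\{0\}$ that is generated by $\mathfrak g_{-1}$; it is of the $\mu$-th kind if $\mathfrak g_{-\mu}\neq\{0\}$ and $\mathfrak g_p=\{0\}$ for $p<-\mu$. A pseudo-product FGLA with pseudo-product structure $(\mathfrak e,\mathfrak f)$ is an FGLA $\mathfrak m$ with nonzero subspaces $\mathfrak e,\mathfrak f\subset\mathfrak g_{-1}$ such that $\mathfrak g_{-1}=\mathfrak e\oplus\mathfrak f$ and $[\mathfrak e,\mathfrak e]=[\mathfrak f,\mathfrak f]=\{0\}$; it is denoted $(\mathfrak m;\mathfrak e,\mathfrak f)$. If it is of the $\mu$-th kind, $\mu\ge2$, it is a free pseudo-product FGLA of type $(m,n,\mu)$ if $\dim\mathfrak e=m$, $\dim\mathfrak f=n$, and for every pseudo-product FGLA $\mathfrak m'=\bigoplus_{p<0}\mathfrak g'_p$ of the $\mu$-th kind with structure $(\mathfrak e',\mathfrak f')$, every surjective linear map $\varphi:\mathfrak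 g_{-1}\to\mathfrak g'_{-1}$ with $\varphi(\mathfrak e)\subset\mathfrak e'$, $\varphi(\mathfrak f)\subset\mathfrak f'$ extends uniquely to a GLA epimorphism $\mathfrak m\to\mathfrak m'$. The prolongation $\mathfrak g(\mathfrak m)=\bigoplus_{p\in\mathbb Z}\mathfrak g(\mathfrak m)_p$ of an FGLA $\mathfrak m$ is the maximal transitive GLA with $\mathfrak g(\mathfrak m)_p=\mathfrak g_p$ for all $p<0$. Explicitly, $\mathfrak g(\mathfrak m)_0$ is the Lie algebra of degree-$0$ derivations of $\mathfrak m$, and for $k\ge1$, inductively, $\mathfrak g(\mathfrak m)_k$ is the space of linear maps $X:\mathfrak m\to\bigoplus_{p\le k-1}\mathfrak g(\mathfrak m)_p$ of degree $k$ with $X([u,v])=[X(u),v]+[u,X(v)]$ for all $u,v\in\mathfrak m$, where $[X,u]=-[u,X]=X(u)$; for $X,Y$ of nonnegative degree, $[X,Y](u)=[X,[Y,u]]-[Y,[X,u]]$ inductively. The prolongation $\mathfrak g=\bigoplus_{p}\mathfrak g_p$ of $(\mathfrak m;\mathfrak e,\mathfrak f)$ is the graded subalgebra of $\mathfrak g(\mathfrak m)$ with negative part $\mathfrak m$, with $\mathfrak g_0$ the Lie algebra of degree-$0$ derivations of $\mathfrak m$ preserving $\mathfrak e$ and $\mathfrak f$, and, inductively for $p\ge1$, $\mathfrak g_p=\{X\in\mathfrak g(\mathfrak m)_p:[X,\mathfrak g_k]\subset\mathfrak g_{p+k}\text{ for all }k<0\}$. $\operatorname{Aut}(\mathfrak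 g)_0=\{\varphi\in\operatorname{Aut}(\mathfrak g):\varphi(\mathfrak g_p)=\mathfrak g_p\text{ for all }p\in\mathbb Z\}$ and $\operatorname{Aut}(\mathfrak g;\mathfrak e,\mathfrak f)_0=\{\varphi\in\operatorname{Aut}(\mathfrak g)_0:\varphi(\mathfrak e)=\mathfrak e,\ \varphi(\mathfrak f)=\mathfrak f\}$. *)

(* Defs.v *)
From HB Require Import structures.
From mathcomp Require Import all_boot all_order all_algebra.
From mathcomp Require Import complex zify.
From mathcomp Require Import boolp classical_sets reals.

Set Implicit Arguments.
Unset Strict Implicit.
Unset Printing Implicit Defensive.

Import Order.TTheory GRing.Theory Num.Theory.
Local Open Scope classical_set_scope.
Local Open Scope ring_scope.

HB.mixin Record Lmodule_isLie (K : fieldType) L of GRing.Lmodule K L := {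
  lie : L -> L -> L;
  lie_linearl : forall (a : K) x y z,
    lie (a *: x + y) z = a *: lie x z + lie y z;
  lie_linearr : forall (a : K) x y z,
    lie z (a *: x + y) = a *: lie z x + lie z y;
  liexx : forall x, lie x x = 0;
  lie_jacobi : forall x y z,
    lie x (lie y z) + lie y (lie z x) + lie z (lie x y) = 0
}.

#[short(type="lieType")]
HB.structure Definition LieAlgebra (K : fieldType) :=
  {L of Lmodule_isLie K L & GRing.Lmodule K L}.

(** [gr p] is the homogeneous component of degree [p]; the carrier is the
    internal direct sum of the components, and may be infinite-dimensional. *)
HB.mixin Record Lie_isGraded (K : fieldType) L of LieAlgebra K L := {
  gr : int -> set L;
  gr0 : forall p, gr p 0;
  gr_linear : forall p (a : K) x y, gr p x -> gr p y -> gr p (a *: x + y);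
  gr_findim : forall p, exists s : seq L,
    forall x, gr p x -> exists c : nat -> K, x = \sum_(i < size s) c i *: s`_i;
  gr_span : forall x : L, exists (s : seq int) (c : int -> L),
    [/\ uniq s, forall p, gr p (c p) & x = \sum_(p <- s) c p];
  gr_direct : forall (s : seq int) (c : int -> L), uniq s ->
    (forall p, gr p (c p)) -> \sum_(p <- s) c p = 0 ->
    forall p, p \in s -> c p = 0;
  gr_lie : forall p q x y, gr p x -> gr q y -> gr (p + q) (lie x y)
}.

#[short(type="glaType")]
HB.structure Definition GradedLie (K : fieldType) :=
  {L of Lie_isGraded K L & LieAlgebra K L}.

#[short(type="finGlaType")]
HB.structure Definition FinGradedLie (K : fieldType) :=
  {L of GradedLie K L & Vector K L}.

Arguments gr_linear {K s p} a {x y}.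
Arguments gr_lie {K s p q x y}.

Section LieTheory.
Variables (K : fieldType) (L : lieType K).
Implicit Types x y z : L.

Lemma lieDl x y z : lie (x + y) z = lie x z + lie y z.
Proof. by have := lie_linearl 1 x y z; rewrite !scale1r. Qed.

Lemma lieDr x y z : lie z (x + y) = lie z x + lie z y.
Proof. by have := lie_linearr 1 x y z; rewrite !scale1r. Qed.

Lemma lie0x x : lie 0 x = 0.
Proof. by have /eqP := lieDl 0 0 x; rewrite addr0 -subr_eq0 opprD addrA subrr sub0r oppr_eq0 => /eqP. Qed.

Lemma liex0 x : lie x 0 = 0.
Proof. by have /eqP := lieDr 0 0 x; rewrite addr0 -subr_eq0 opprD addrA subrr sub0r oppr_eq0 => /eqP. Qed.

Lemma lieC x y : lie x y = - lie y x.
Proof.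
have := liexx (x + y); rewrite lieDl !lieDr !liexx add0r addr0 => /eqP.
by rewrite addr_eq0 => /eqP.
Qed.

Lemma lieNr x y : lie x (- y) = - lie x y.
Proof. by have := lie_linearr (-1) y 0 x; rewrite !addr0 !scaleN1r liex0 addr0. Qed.

Lemma lie_lie x y z : lie (lie x y) z = lie x (lie y z) - lie y (lie x z).
Proof.
have /eqP := lie_jacobi x y z.
rewrite addr_eq0 => /eqP E; rewrite [LHS]lieC -E.
by rewrite [lie z x]lieC lieNr.
Qed.

Lemma lie_suml (I : Type) (s : seq I) (c : I -> L) y :
  lie (\sum_(i <- s) c i) y = \sum_(i <- s) lie (c i) y.
Proof. by elim/big_ind2: _ => [|a b d e' <- <-|//]; rewrite ?lie0x ?lieDl. Qed.

Lemma lie_sumr (I : Type) (s : seq I) (c : I -> L) y :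
  lie y (\sum_(i <- s) c i) = \sum_(i <- s) lie y (c i).
Proof. by elim/big_ind2: _ => [|a b d e' <- <-|//]; rewrite ?liex0 ?lieDr. Qed.

End LieTheory.

Lemma gr_opp (K : fieldType) (L : glaType K) p (x : L) : gr p x -> gr p (- x).
Proof. by move=> px; have := gr_linear (-1) px (gr0 p); rewrite scaleN1r addr0. Qed.

Lemma gr_sub (K : fieldType) (L : glaType K) p (x y : L) :
  gr p x -> gr p y -> gr p (x - y).
Proof. by move=> px /gr_opp py; have := gr_linear 1 px py; rewrite scale1r. Qed.

Lemma span_sub_findim (K : fieldType) (L M : lmodType K) (v : {linear L -> M})
    (S : set L) (s : seq M) :
  injective v -> (forall a x y, S x -> S y -> S (a *: x + y)) ->
  (forall x, S x -> exists c : nat -> K, v x = \sum_(i < size s) c i *: s`_i) ->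
  exists t : seq L, forall x, S x ->
    exists c : nat -> K, x = \sum_(i < size t) c i *: t`_i.
Proof.
move=> vI; elim: s S => [|a s IH] S Slin Ss.
  exists [::] => x /Ss[c]; rewrite !big_ord0 => vx.
  by exists c; rewrite big_ord0; apply: vI; rewrite vx linear0.
pose T := [set x | S x /\ exists c : nat -> K,
                     v x = \sum_(i < size s) c i *: s`_i].
have [|x [_ //]|t Tt] := IH T.
  move=> k x y [Sx [c Ec]] [Sy [d Ed]]; split; first exact: Slin.
  exists (fun i => k * c i + d i); rewrite linearP Ec Ed scaler_sumr -big_split.
  by apply: eq_bigr => i _; rewrite /= scalerDl scalerA.
case: (pselect (S `<=` T)) => [ST|/existsNP[x0 /not_implyP[Sx0 nT]]].
  by exists t => x /ST/Tt.
have [c0 Ec0] := Ss _ Sx0; rewrite big_ord_recl /= in Ec0.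
have c00 : c0 0%N != 0.
  apply/eqP => c00; apply: nT; split=> //.
  by exists (c0 \o succn); rewrite Ec0 c00 scale0r add0r.
exists (x0 :: t) => x Sx; have [c Ec] := Ss _ Sx; rewrite big_ord_recl /= in Ec.
set k := c 0%N / c0 0%N.
have [|d Ed] := Tt (- k *: x0 + x).
  split; first exact: Slin.
  exists (fun i => - k * c0 i.+1 + c i.+1).
  rewrite linearP Ec Ec0 scalerDr scalerA mulNr divfK // scaleNr addrACA addNr.
  rewrite add0r scaler_sumr -big_split; apply: eq_bigr => i _.
  by rewrite /= scalerDl scalerA.
exists (fun i => if i is j.+1 then d j else k).
by rewrite big_ord_recl /= -Ed scaleNr addrA subrr add0r.
Qed.

Definition transitive_gla (K : fieldType) (L : glaType K) : Prop :=
  forall (p : int) (X : L), 0 <= p -> gr p X ->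
    (forall (q : int) (y : L), q < 0 -> gr q y -> lie X y = 0) -> X = 0.

Definition is_fgla (K : fieldType) (m : finGlaType K) : Prop :=
  [/\ forall p : int, 0 <= p -> gr p = [set (0 : m)],
      gr (-1) <> [set (0 : m)]
    & forall U : {vspace m}, (forall x : m, gr (-1) x -> x \in U) ->
        (forall x y : m, x \in U -> y \in U -> lie x y \in U) ->
        U = fullv].

Definition is_kind (K : fieldType) (m : finGlaType K) (mu : nat) : Prop :=
  gr (- mu%:Z) <> [set (0 : m)] /\
  forall p : int, p < - mu%:Z -> gr p = [set (0 : m)].

Definition is_pseudo_product (K : fieldType) (m : finGlaType K)
    (e f : {vspace m}) : Prop :=
  is_fgla m /\
  [/\ e != 0%VS /\ f != 0%VS,
      gr (-1) = [set x | x \in (e + f)%VS] /\ (e :&: f)%VS = 0%VS,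
      forall x y, x \in e -> y \in e -> lie x y = 0
    & forall x y, x \in f -> y \in f -> lie x y = 0].

Definition is_gla_epi (K : fieldType) (m m' : finGlaType K)
    (psi : 'Hom(m, m')) : Prop :=
  [/\ forall x y, psi (lie x y) = lie (psi x) (psi y),
      forall p x, gr p x -> gr p (psi x)
    & limg psi = fullv].

(** A linear map from the degree -1 part of [m] to that of [m'] is given as the
    restriction of a linear map [phi : 'Hom(m, m')]; the values of [phi] outside
    the degree -1 part are never used. *)
Definition is_free_pseudo_product (K : fieldType) (m : finGlaType K)
    (e f : {vspace m}) (a b mu : nat) : Prop :=
  [/\ is_pseudo_product e f /\ is_kind m mu,
      (2 <= mu)%N,
      \dim e = a /\ \dim f = b
    & forall (m' : finGlaType K) (e' f' : {vspace m'}),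
        is_pseudo_product e' f' -> is_kind m' mu ->
        forall phi : 'Hom(m, m'),
          phi @` gr (-1) = gr (-1) ->
          (phi @: e <= e')%VS -> (phi @: f <= f')%VS ->
          exists! psi : 'Hom(m, m'),
            is_gla_epi psi /\ forall x, gr (-1) x -> psi x = phi x].

Definition is_prolongation_map (K : fieldType) (m : finGlaType K)
    (M : glaType K) (iota : m -> M) (k : int) (D : m -> M) : Prop :=
  (forall p u, gr p u -> gr (k + p) (D u)) /\
  forall u v, D (lie u v) = lie (D u) (iota v) + lie (iota u) (D v).

(** [M], together with the embedding [iota] of [m] as its negative part, is
    the prolongation g(m): for [k >= 0], the map [X |-> (u |-> lie X (iota u))]
    identifies [gr k] with the space of all linear maps of degree [k] from [m]
    to [M] satisfying the Leibniz rule (injectivity is transitivity).  For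
    [k = 0] these are the degree-0 derivations of [m].  This determines
    [(M, iota)] up to a unique isomorphism. *)
Definition is_prolongation (K : fieldType) (m : finGlaType K) (M : glaType K)
    (iota : {linear m -> M}) : Prop :=
  [/\ injective iota /\ (forall u v, iota (lie u v) = lie (iota u) (iota v)),
      forall p : int, p < 0 -> iota @` gr p = gr p,
      transitive_gla M
    & forall (k : int) (D : {linear m -> M}), 0 <= k ->
        is_prolongation_map iota k D ->
        exists2 X : M, gr k X & forall u, D u = lie X (iota u)].

Section PseudoProductProlongation.
Variables (K : fieldType) (m : vectType K) (M : glaType K).
Variables (iota : {linear m -> M}) (e f : {vspace m}).

Definition ad_stable (X : M) (U : {vspace m}) : Prop :=
  forall u, u \in U -> exists2 v, v \in U & lie X (iota u) = iota v.

Inductive pp_piece (p : int) (X : M) : Prop :=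
| PPNeg of p < 0 & gr p X
| PPZero of p = 0 & gr p X & ad_stable X e & ad_stable X f
| PPPos of 0 < p & gr p X &
    (forall (k : int) (Y : M), k < 0 -> gr k Y -> pp_piece (p + k) (lie X Y)).

Definition pp_mem : {pred M} := fun X =>
  `[< exists (s : seq int) (c : int -> M),
      [/\ uniq s, forall p, pp_piece p (c p) & X = \sum_(p <- s) c p] >].

Lemma pp_gr p X : pp_piece p X -> gr p X.
Proof. by case. Qed.

Lemma ad_stable_linear a X Y U :
  ad_stable X U -> ad_stable Y U -> ad_stable (a *: X + Y) U.
Proof.
move=> hX hY u uU; have [v vU Ev] := hX u uU; have [w wU Ew] := hY u uU.
exists (a *: v + w); first by rewrite memvD ?memvZ.
by rewrite lie_linearl Ev Ew linearP.
Qed.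

Lemma ad_stable_lie X Y U :
  ad_stable X U -> ad_stable Y U -> ad_stable (lie X Y) U.
Proof.
move=> hX hY u uU; have [v vU Ev] := hX u uU; have [w wU Ew] := hY u uU.
have [v' v'U Ev'] := hY v vU; have [w' w'U Ew'] := hX w wU.
exists (w' - v'); first by rewrite memvB.
by rewrite lie_lie Ew Ev Ev' Ew' linearB.
Qed.

Lemma int_nonneg_ind (P : int -> Prop) :
  (forall p, (forall q, q < p -> P q) -> 0 <= p -> P p) ->
  (forall p, p < 0 -> P p) -> forall p, P p.
Proof.
move=> H Hn p; case: (ltP p 0) => [/Hn //|p0].
have [n pn] : exists n : nat, p < n%:Z.
  by exists `|p|%N.+1; rewrite -addn1 PoszD gez0_abs // ltrDl.
elim: n => [|n IH] in p p0 pn *; first by rewrite ltNge p0 in pn.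
apply: (H) => // q qp; case: (ltP q 0) => [/Hn //|q0]; apply: IH => //.
by lia.
Qed.

Lemma pp_linear p a X Y : pp_piece p X -> pp_piece p Y -> pp_piece p (a *: X + Y).
Proof.
elim/int_nonneg_ind: p a X Y => [p IH p0|p p0] a X Y; last first.
  by move=> /pp_gr hX /pp_gr hY; apply: PPNeg => //; apply: gr_linear.
case=> [|pE gX Xe Xf|pp gX hX]; first by rewrite ltNge p0.
  case=> [|_ gY Ye Yf|]; [by rewrite ltNge p0| |by rewrite pE ltxx].
  by apply: PPZero; [|exact: gr_linear|exact: ad_stable_linear..].
case=> [|pE|_ gY hY]; [by rewrite ltNge p0|by rewrite pE ltxx in pp|].
apply: PPPos => //; first exact: gr_linear.
move=> k Z k0 gZ; rewrite lie_linearl; apply: IH; [|exact: hX|exact: hY].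
by rewrite gtrDl.
Qed.

Lemma pp0 p : pp_piece p 0.
Proof.
elim/int_nonneg_ind: p => [p IH p0|p p0]; last by apply: PPNeg => //; exact: gr0.
have h0 U : ad_stable 0 U by move=> u _; exists 0; rewrite ?mem0v // lie0x linear0.
move: p0; rewrite le_eqVlt => /orP[/eqP pE|p0].
  by apply: PPZero => //; exact: gr0.
apply: PPPos => //; first exact: gr0.
by move=> k Y k0 _; rewrite lie0x; apply: IH; rewrite gtrDl.
Qed.

Lemma pp_opp p X : pp_piece p X -> pp_piece p (- X).
Proof. by move=> h; have := pp_linear (-1) h (pp0 p); rewrite scaleN1r addr0. Qed.

Lemma pp_lieneg p q X Y : q < 0 -> pp_piece p X -> gr q Y -> pp_piece (p + q) (lie X Y).
Proof.
move=> q0 hX gY; case: (hX) => [p0 gX|pE gX _ _|_ _]; last exact.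
  by apply: PPNeg; [lia|exact: gr_lie].
by apply: PPNeg; [rewrite pE add0r|exact: gr_lie].
Qed.

Lemma pp_lie p q X Y : pp_piece p X -> pp_piece q Y -> pp_piece (p + q) (lie X Y).
Proof.
move: {2}(p + q) (erefl (p + q)) => r.
elim/int_nonneg_ind: r p q X Y => [r IH r0|r r0] p q X Y Er hX hY; last first.
  by apply: PPNeg; [rewrite Er|apply: gr_lie; apply: pp_gr].
case: (ltP q 0) => [q0|q0]; first exact: pp_lieneg (pp_gr hY).
case: (ltP p 0) => [p0|p0].
  by rewrite lieC addrC; apply/pp_opp/pp_lieneg => //; exact: pp_gr.
have gXY := gr_lie (pp_gr hX) (pp_gr hY).
move: (r0); rewrite le_eqVlt => /orP[/eqP rE|rp].
  have [pE qE] : p = 0 /\ q = 0 by lia.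
  case: hX => [|_ _ Xe Xf|]; [by rewrite pE ltxx| |by rewrite pE ltxx].
  case: hY => [|_ _ Ye Yf|]; [by rewrite qE ltxx| |by rewrite qE ltxx].
  by apply: PPZero => //; [lia|exact: ad_stable_lie..].
apply: PPPos => //; first by lia.
move=> k Z k0 gZ; rewrite lie_lie.
have h1 : pp_piece (p + q + k) (lie X (lie Y Z)).
  rewrite -addrA; apply: (IH (r + k)); [lia|lia|exact: hX|exact: pp_lieneg].
have h2 : pp_piece (p + q + k) (lie Y (lie X Z)).
  rewrite [p + q]addrC -addrA.
  by apply: (IH (r + k)); [lia|lia|exact: hY|exact: pp_lieneg].
by have := pp_linear (-1) h2 h1; rewrite scaleN1r [- _ + _]addrC.
Qed.

Lemma pp_mem_piece p X : pp_piece p X -> X \in pp_mem.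
Proof.
move=> pX; apply/asboolP; exists [:: p], (fun q => if q == p then X else 0).
by split; rewrite ?big_seq1 ?eqxx // => q; case: eqP => [->//|_]; exact: pp0.
Qed.

Lemma pp_mem_submod : submod_closed pp_mem.
Proof.
split; first exact: pp_mem_piece (pp0 0).
move=> a X Y /asboolP[s [c [us hc ->]]] /asboolP[t [d [ut hd ->]]].
pose c' p := if p \in s then c p else 0.
pose d' p := if p \in t then d p else 0.
have hc' p : pp_piece p (c' p) by rewrite /c'; case: ifP => // _; exact: pp0.
have hd' p : pp_piece p (d' p) by rewrite /d'; case: ifP => // _; exact: pp0.
apply/asboolP; exists (undup (s ++ t)), (fun p => a *: c' p + d' p).
split; [exact: undup_uniq|by move=> p; exact: pp_linear|].
have ext (u : seq int) (b : int -> M) : uniq u -> {subset u <= s ++ t} ->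
    \sum_(p <- u) b p = \sum_(p <- undup (s ++ t)) (if p \in u then b p else 0).
  move=> uu us'; rewrite -big_mkcond /= -[RHS]big_filter; apply: perm_big.
  apply: uniq_perm => //; first by rewrite filter_uniq ?undup_uniq.
  move=> p; rewrite mem_filter mem_undup; case: (boolP (p \in u)) => //= pu.
  by rewrite us'.
rewrite big_split /= -scaler_sumr; congr (_ *: _ + _); apply: ext => //.
  by move=> p ps; rewrite mem_cat ps.
by move=> p ps; rewrite mem_cat ps orbT.
Qed.

HB.instance Definition _ := GRing.isSubmodClosed.Build K M pp_mem pp_mem_submod.

Lemma pp_mem_sum (I : Type) (r : seq I) (c : I -> M) :
  (forall i, c i \in pp_mem) -> \sum_(i <- r) c i \in pp_mem.
Proof. by move=> h; apply: rpred_sum. Qed.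

Lemma pp_mem_lie X Y : X \in pp_mem -> Y \in pp_mem -> lie X Y \in pp_mem.
Proof.
move=> /asboolP[s [c [us hc ->]]] /asboolP[t [d [ut hd ->]]].
rewrite lie_suml; apply: pp_mem_sum => p; rewrite lie_sumr.
by apply: pp_mem_sum => q; apply: (@pp_mem_piece (p + q)); exact: pp_lie.
Qed.

(** The prolongation of [(m; e, f)], as a graded subalgebra of [M]. *)
Record pp_prolongation := PPProlongation {
  pp_val : M;
  _ : pp_val \in pp_mem
}.

HB.instance Definition _ := [isSub for pp_val].
HB.instance Definition _ := [Choice of pp_prolongation by <:].
HB.instance Definition _ := [SubChoice_isSubLmodule of pp_prolongation by <:].

Definition pp_lie_op (X Y : pp_prolongation) : pp_prolongation :=
  PPProlongation (pp_mem_lie (valP X) (valP Y)).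

Fact pp_lie_linearl (a : K) X Y Z :
  pp_lie_op (a *: X + Y) Z = a *: pp_lie_op X Z + pp_lie_op Y Z.
Proof. by apply: val_inj; rewrite /= lie_linearl. Qed.

Fact pp_lie_linearr (a : K) X Y Z :
  pp_lie_op Z (a *: X + Y) = a *: pp_lie_op Z X + pp_lie_op Z Y.
Proof. by apply: val_inj; rewrite /= lie_linearr. Qed.

Fact pp_liexx X : pp_lie_op X X = 0.
Proof. by apply: val_inj; rewrite /= liexx. Qed.

Fact pp_lie_jacobi X Y Z :
  pp_lie_op X (pp_lie_op Y Z) + pp_lie_op Y (pp_lie_op Z X)
  + pp_lie_op Z (pp_lie_op X Y) = 0.
Proof. by apply: val_inj; rewrite /= lie_jacobi. Qed.

HB.instance Definition _ := Lmodule_isLie.Build K pp_prolongation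
  pp_lie_linearl pp_lie_linearr pp_liexx pp_lie_jacobi.

Definition pp_gr_op (p : int) : set pp_prolongation :=
  [set X | pp_piece p (pp_val X)].

Fact pp_gr0 p : pp_gr_op p 0.
Proof. exact: pp0. Qed.

Fact pp_gr_linear p (a : K) X Y :
  pp_gr_op p X -> pp_gr_op p Y -> pp_gr_op p (a *: X + Y).
Proof. exact: pp_linear. Qed.

Fact pp_gr_findim p : exists s : seq pp_prolongation,
  forall x, pp_gr_op p x ->
    exists c : nat -> K, x = \sum_(i < size s) c i *: s`_i.
Proof.
have [s hs] := gr_findim p (s := M).
apply: (@span_sub_findim _ _ _ (\val : pp_prolongation -> M) _ s).
- exact: val_inj.
- exact: pp_gr_linear.
- by move=> X /pp_gr /hs.
Qed.

Lemma pp_val_sum (I : Type) (r : seq I) (c : I -> pp_prolongation) :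
  pp_val (\sum_(i <- r) c i) = \sum_(i <- r) pp_val (c i).
Proof. exact: (linear_sum (\val : pp_prolongation -> M)). Qed.

Fact pp_gr_span X : exists (s : seq int) (c : int -> pp_prolongation),
  [/\ uniq s, forall p, pp_gr_op p (c p) & X = \sum_(p <- s) c p].
Proof.
have /asboolP[s [c [us hc E]]] := valP X.
exists s, (fun p => PPProlongation (pp_mem_piece (hc p))); split=> //.
by apply: val_inj; rewrite /= pp_val_sum.
Qed.

Fact pp_gr_direct (s : seq int) (c : int -> pp_prolongation) : uniq s ->
  (forall p, pp_gr_op p (c p)) -> \sum_(p <- s) c p = 0 ->
  forall p, p \in s -> c p = 0.
Proof.
move=> us hc /(congr1 pp_val); rewrite pp_val_sum => E p ps; apply: val_inj.
by apply: (gr_direct _ _ us _ E _ ps) => q; apply: pp_gr; exact: hc.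
Qed.

Fact pp_gr_lie p q X Y :
  pp_gr_op p X -> pp_gr_op q Y -> pp_gr_op (p + q) (lie X Y).
Proof. exact: pp_lie. Qed.

HB.instance Definition _ := Lie_isGraded.Build K pp_prolongation
  pp_gr0 pp_gr_linear pp_gr_findim pp_gr_span pp_gr_direct pp_gr_lie.

(** The inclusion of [m] into the prolongation (with the default value [0]
    outside it, which never occurs under [is_prolongation iota]). *)
Definition pp_incl (u : m) : pp_prolongation := insubd 0 (iota u).

Definition pp_sub (U : {vspace m}) : set pp_prolongation :=
  pp_incl @` [set u | u \in U].

End PseudoProductProlongation.

Arguments pp_incl {K m M} iota e f u.
Arguments pp_sub {K m M} iota e f U.

Lemma val_pp_incl (K : fieldType) (m : finGlaType K) (M : glaType K)
    (iota : {linear m -> M}) (e f : {vspace m}) (u : m) :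
  is_fgla m -> is_prolongation iota ->
  pp_val (pp_incl iota e f u) = iota u.
Proof.
move=> [m0 _ _] [_ iota_gr _ _]; rewrite -[LHS]/(val _) val_insubd ifT //.
have [s [c [us hc ->]]] := gr_span u.
rewrite linear_sum; apply: pp_mem_sum => p.
case: (ltP p 0) => [p0|p0].
  by apply: (@pp_mem_piece _ _ _ _ _ _ p); apply: PPNeg; rewrite // -iota_gr //; exists (c p).
by have := hc p; rewrite m0 // => ->; rewrite linear0 rpred0.
Qed.

Section GeneralLinearGroup.
Variables (K : fieldType) (V : lmodType K).

Record GL := MkGL {
  gl_fun :> V -> V;
  gl_linear : linear gl_fun;
  gl_bij : bijective gl_fun
}.

HB.instance Definition _ := gen_eqMixin GL.
HB.instance Definition _ := gen_choiceMixin GL.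
HB.instance Definition _ (g : GL) :=
  GRing.isLinear.Build K V V *:%R (gl_fun g) (gl_linear g).

Lemma gl_ext (g h : GL) : g =1 h -> g = h.
Proof.
case: g h => [g gl gb] [h hl hb] /= /funext gh; subst h.
by congr MkGL; exact: Prop_irrelevance.
Qed.

Fact gl_one_linear : linear (@id V). Proof. by []. Qed.
Definition gl_one : GL :=
  MkGL gl_one_linear (Bijective (fun=> erefl) (fun=> erefl)).

Fact gl_mul_linear (g h : GL) : linear (g \o h).
Proof. by move=> a x y /=; rewrite !linearP. Qed.
Definition gl_mul (g h : GL) : GL :=
  MkGL (gl_mul_linear g h) (bij_comp (gl_bij g) (gl_bij h)).

Fact gl_inv_ex (g : GL) : exists h : GL, cancel g h /\ cancel h g.
Proof.
have [h gK hK] := gl_bij g.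
have hl : linear h by move=> a x y; apply: (can_inj gK); rewrite hK linearP /= !hK.
by exists (MkGL hl (Bijective hK gK)).
Qed.
Definition gl_inv (g : GL) : GL := sval (cid (gl_inv_ex g)).

Fact gl_mulA : associative gl_mul.
Proof. by move=> g h k; exact: gl_ext. Qed.
Fact gl_mul1 : left_id gl_one gl_mul.
Proof. by move=> g; exact: gl_ext. Qed.
Fact gl_1mul : right_id gl_one gl_mul.
Proof. by move=> g; exact: gl_ext. Qed.
Fact gl_mulV : left_inverse gl_one gl_inv gl_mul.
Proof. by move=> g; apply: gl_ext => x; rewrite /gl_inv /=; case: cid => h [/= ->]. Qed.
Fact gl_Vmul : right_inverse gl_one gl_inv gl_mul.
Proof. by move=> g; apply: gl_ext => x; rewrite /gl_inv /=; case: cid => h [/= _ ->]. Qed.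

HB.instance Definition _ := isGroup.Build GL gl_mulA gl_mul1 gl_1mul gl_mulV gl_Vmul.

End GeneralLinearGroup.

Section Automorphisms.
Variables (K : fieldType) (L : glaType K).

Definition aut0 : set (GL L) :=
  [set phi | (forall x y, phi (lie x y) = lie (phi x) (phi y)) /\
             forall p : int, phi @` gr p = gr p].

Definition aut0_stab (E F : set L) : set (GL L) :=
  [set phi | [/\ aut0 phi, phi @` E = E & phi @` F = F]].

Lemma glVK (phi : GL L) : cancel phi (phi^-1)%g.
Proof. by move=> x; exact: (congr1 (fun g : GL L => g x) (mulVg phi)). Qed.

Lemma glKV (phi : GL L) : cancel (phi^-1)%g phi.
Proof. by move=> x; exact: (congr1 (fun g : GL L => g x) (mulgV phi)). Qed.

Lemma gl_image_comp (phi psi : GL L) (A : set L) :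
  phi @` A = A -> psi @` A = A -> (phi * psi)%g @` A = A.
Proof. by move=> hphi hpsi; rewrite -{2}hphi -{2}hpsi image_comp. Qed.

Lemma gl_image_inv (phi : GL L) (A : set L) :
  phi @` A = A -> (phi^-1)%g @` A = A.
Proof.
move=> hphi; apply/seteqP; split=> [x [y Ay <-]|x Ax].
  by move: Ay; rewrite -{1}hphi => -[z Az <-]; rewrite glVK.
by exists (phi x); [rewrite -hphi; exists x|exact: glVK].
Qed.

Lemma aut0_stab_group (E F : set L) :
  group_closed (fun phi : GL L => phi \in aut0_stab E F).
Proof.
split=> [|phi psi]; rewrite inE.
  split; [split|exact: image_id..] => // p; exact: image_id.
rewrite !unfold_in !inE => -[[phiM phi_gr] phiE phiF] [[psiM psi_gr] psiE psiF].
split; [split=> [x y|p]|..]; try by apply/gl_image_comp/gl_image_inv.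
rewrite [LHS]/= -phiM; congr (phi _); apply: (can_inj (glVK psi)).
by rewrite psiM !glKV.
Qed.

Record aut0_group (E F : set L) := MkAut0 {
  aut0_val :> GL L;
  _ : aut0_val \in aut0_stab E F
}.

HB.instance Definition _ E F := [isSub for @aut0_val E F].
HB.instance Definition _ E F := [Choice of aut0_group E F by <:].
HB.instance Definition _ E F := SubChoice_isSubGroup.Build (GL L)
  (fun phi => phi \in aut0_stab E F) (aut0_group E F) (aut0_stab_group E F).

End Automorphisms.

(* Main.v *)
(* A graded automorphism of m extends degree by degree to its prolongation,
   uniquely since g(m) is transitive; freeness, applied with m itself as the
   target, extends every element of GL(e) x GL(f) to m.  This gives the first
   part.

   For the second part, freeness makes e x f -> g_{-2} nondegenerate: the
   annihilator in f of a nonzero x in e is invariant under GL(f), so it is 0 or f,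
   and in the latter case [e, f] = 0, which is excluded by mu >= 2.  The
   automorphism equal to 2 on e and 1 on f is diagonalizable with eigenvalues 2^h,
   and its "logarithm" is a derivation D in g_0 with D = 1 on e and D = 0 on f.
   If phi is a graded automorphism of g, then phi(e) and phi(f) are stable under
   g_0, hence under D, and abelian; so each lies in e or in f, and
   dim e <> dim f leaves only phi(e) = e and phi(f) = f. *)
Require Import Defs.
From HB Require Import structures.
From mathcomp Require Import all_boot all_order all_algebra.
From mathcomp Require Import complex zify ring.
From mathcomp Require Import boolp classical_sets reals.

Import Order.TTheory GRing.Theory Num.Theory.

Local Open Scope ring_scope.

Set Implicit Arguments.
Unset Strict Implicit.
Unset Printing Implicit Defensive.

(** * Subspaces, induction over an FGLA, and linear maps given by their graphs *)

Lemma lieBl (K : fieldType) (L : lieType K) (x y z : L) :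
  lie (x - y) z = lie x z - lie y z.
Proof. by rewrite lieDl [lie (- y) z]lieC lieNr opprK [lie z y]lieC. Qed.

(** Take a subspace contained in [S] of maximal dimension: a vector of [S] outside it would span
    with it a larger one. *)
Lemma submod_vspace (K : fieldType) (V : vectType K) (S : V -> Prop) :
  S 0 -> (forall a x y, S x -> S y -> S (a *: x + y)) ->
  exists U : {vspace V}, forall x, x \in U <-> S x.
Proof.
move=> S0 Slin.
pose P n := `[< exists U : {vspace V}, \dim U = n /\ forall x, x \in U -> S x >].
have Pex : exists n, P n.
  exists 0; apply/asboolP; exists 0%VS; split; first exact: dimv0.
  by move=> x; rewrite memv0 => /eqP ->.
have Pbd n : P n -> (n <= \dim {:V})%N.
  by move=> /asboolP[U [<- _]]; exact/dimvS/subvf.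
case: (ex_maxnP Pex Pbd) => n /asboolP[U [dU US]] Umax.
exists U => x; split=> [/US //|Sx]; apply: contraT => xU.
have: P (\dim (U + <[x]>)%VS).
  apply/asboolP; exists (U + <[x]>)%VS; split=> // y /memv_addP[u uU [w]].
  by move=> /vlineP[k ->] ->; rewrite addrC; apply: Slin => //; exact: US.
move=> /Umax; rewrite -dU => dle.
have /eqP UE : (U == U + <[x]>)%VS by rewrite eqEdim addvSl.
by case/negP: xU; rewrite UE (subvP (addvSr U _)) ?memv_line.
Qed.

(** Generation by degree -1 as an induction principle, for predicates not given as a
    [{vspace m}]. *)
Lemma fgla_ind (K : fieldType) (m : finGlaType K) (S : m -> Prop) :
  is_fgla m -> (forall x, gr (-1) x -> S x) ->
  (forall a x y, S x -> S y -> S (a *: x + y)) ->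
  (forall x y, S x -> S y -> S (lie x y)) -> forall x, S x.
Proof.
move=> [_ _ gen] S1 Slin Slie x.
have [U US] := submod_vspace (S1 _ (gr0 _)) Slin.
apply/US; suff -> : U = fullv by rewrite memvf.
by apply: gen => [y /S1 Sy|y z /US Sy /US Sz]; apply/US; last exact: Slie.
Qed.

Section LinearRelations.
Variables (K : fieldType) (V W : lmodType K).

Lemma linear_relation_sum (r : V -> W -> Prop) (I : Type) (s : seq I)
    (Q : pred I) (F : I -> V) (G : I -> W) :
  r 0 0 -> (forall a x y x' y', r x y -> r x' y' -> r (a *: x + x') (a *: y + y')) ->
  (forall i, Q i -> r (F i) (G i)) ->
  r (\sum_(i <- s | Q i) F i) (\sum_(i <- s | Q i) G i).
Proof.
move=> r0 rl rFG; elim/big_rec2: _ => // i y x Qi rxy.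
by have := rl 1 _ _ _ _ (rFG i Qi) rxy; rewrite !scale1r.
Qed.

(** Two values at the same point differ by a value at 0, so a trivial fibre over 0 makes the
    relation single-valued. Later maps are first described by their graphs and then obtained
    here. *)
Lemma linear_relation_fun (r : V -> W -> Prop) :
  (forall x, exists y, r x y) ->
  (forall a x y x' y', r x y -> r x' y' -> r (a *: x + x') (a *: y + y')) ->
  (forall y, r 0 y -> y = 0) ->
  exists F : {linear V -> W}, forall x y, r x y <-> F x = y.
Proof.
move=> rex rl r0; have [f rf] := choice rex.
have runiq x y z : r x y -> r x z -> y = z.
  move=> rxy rxz; have := rl (-1) _ _ _ _ rxz rxy.
  rewrite !scaleN1r addNr => /r0 /eqP; rewrite addrC subr_eq0 => /eqP //.
have flin : linear f.
  by move=> a x y; apply: (runiq _ _ _ (rf _)); exact: rl.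
pose F : {linear V -> W} := HB.pack f (GRing.isLinear.Build K V W _ f flin).
exists F => x y /=.
by split=> [/(runiq _ _ _ (rf x))|<-].
Qed.

End LinearRelations.

(** Gluing of linear graphs given degree by degree; it serves for maps out of [M], which may be
    infinite-dimensional, as well as out of [m]. *)
Lemma graded_extension (K : fieldType) (L : glaType K) (V : lmodType K)
    (r : int -> L -> V -> Prop) :
  (forall p x, gr p x -> exists y, r p x y) ->
  (forall p x y, r p x y -> gr p x) ->
  (forall p a x y x' y', r p x y -> r p x' y' -> r p (a *: x + x') (a *: y + y')) ->
  (forall p y, r p 0 y -> y = 0) ->
  exists F : {linear L -> V}, forall p x y, r p x y -> F x = y.
Proof.
move=> rex rgr rl r0.
have r00 p : r p 0 0 by have [y] := rex p 0 (gr0 p) => /[dup] /r0 ->.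
(* The sum of the homogeneous graphs. Degrees may repeat in [l], so closure under addition is just
   concatenation. *)
pose G x y := exists l : seq (int * (L * V)), (forall i, i \in l -> r i.1 i.2.1 i.2.2) /\
  x = \sum_(i <- l) i.2.1 /\ y = \sum_(i <- l) i.2.2.
have [||y [l [rl' [x0 ->]]]|F FG] := @linear_relation_fun K L V G.
- move=> x; have [s [c [us hc ->]]] := gr_span x.
  have [d hd] := choice (fun p => rex p _ (hc p)).
  exists (\sum_(p <- s) d p), [seq (p, (c p, d p)) | p <- s].
  by rewrite !big_map; split=> // i /mapP[p _ ->].
- move=> a _ _ _ _ [l [rl1 [-> ->]]] [l' [rl2 [-> ->]]].
  exists ([seq (i.1, (a *: i.2.1, a *: i.2.2)) | i <- l] ++ l').
  rewrite !big_cat !big_map /= !scaler_sumr; split=> // i.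
  rewrite mem_cat => /orP[/mapP[j /rl1 rj ->]|/rl2 //] /=.
  by have := rl _ a _ _ _ _ rj (r00 j.1); rewrite !addr0.
(* Collect the terms of equal degree: directness of the grading kills each degree part of the first
   components, and the trivial fibre over 0 kills the matching second components. *)
- pose s := undup [seq i.1 | i <- l].
  have part (W : zmodType) (h : int * (L * V) -> W) :
      \sum_(i <- l) h i = \sum_(p <- s) \sum_(i <- l | i.1 == p) h i.
    rewrite (exchange_big_dep predT) //= big_seq [RHS]big_seq.
    apply: eq_bigr => i il; rewrite -big_filter.
    have is_ : i.1 \in s by rewrite mem_undup map_f.
    have := filter_pred1_uniq (undup_uniq [seq j.1 | j <- l]) is_.
    by under eq_filter do rewrite /= eq_sym; move=> ->; rewrite big_seq1.
  have rpart p : r p (\sum_(i <- l | i.1 == p) i.2.1) (\sum_(i <- l | i.1 == p) i.2.2).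
    rewrite big_seq_cond [X in r p _ X]big_seq_cond.
    apply: linear_relation_sum => //; first exact: rl.
    by move=> i /andP[/rl' ri /eqP <-].
  rewrite part in x0; rewrite part big_seq big1 // => p ps; apply: (r0 p).
  have /= x0p := gr_direct _ _ (undup_uniq _) (fun p => rgr _ _ _ (rpart p))
    (esym x0) _ ps.
  by have := rpart p; rewrite x0p.
exists F => p x y rxy; apply/FG; exists [:: (p, (x, y))].
by rewrite !big_seq1; split=> // i; rewrite inE => /eqP ->.
Qed.

Lemma gr_linear_ext (K : fieldType) (L : glaType K) (V : lmodType K)
    (F G : {linear L -> V}) :
  (forall p x, gr p x -> F x = G x) -> F =1 G.
Proof.
move=> FG x; have [s [c [_ hc ->]]] := gr_span x.
by rewrite !linear_sum; apply: eq_bigr => p _; exact: FG (hc p).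
Qed.

Definition is_gla_hom (K : fieldType) (L L' : glaType K) (F : L -> L') : Prop :=
  (forall x y, F (lie x y) = lie (F x) (F y)) /\
  (forall p x, gr p x -> gr p (F x)).

Lemma fgla_hom_ext (K : fieldType) (m : finGlaType K) (L : glaType K)
    (F G : {linear m -> L}) : is_fgla m -> is_gla_hom F -> is_gla_hom G ->
  (forall x, gr (-1) x -> F x = G x) -> F =1 G.
Proof.
move=> mF [FM _] [GM _] FG; apply: (fgla_ind mF) => // [a x y|x y].
  by rewrite !linearP => -> ->.
by rewrite FM GM => -> ->.
Qed.

(** Induction on the degree: for [z] of negative degree, the bracket of [F x - G x] with [F z] is
    [F - G] at [lie x z], which has lower degree, hence 0. Such [F z] exhaust the negative part, so
    transitivity applies. *)
Lemma gla_hom_ext (K : fieldType) (L : glaType K) (F G : {linear L -> L}) :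
  transitive_gla L -> is_gla_hom F -> is_gla_hom G ->
  (forall p x, p < 0 -> gr p x -> exists2 y, gr p y & F y = x) ->
  (forall p x, p < 0 -> gr p x -> F x = G x) -> F =1 G.
Proof.
move=> tL [FM Fg] [GM Gg] Fonto FG; apply: gr_linear_ext.
elim/int_nonneg_ind => [p IH p0|p p0] x gx; last exact: FG gx.
apply/eqP; rewrite -subr_eq0; apply/eqP; apply: (tL p) => // [|q y q0 gy].
  by apply: gr_sub; [exact: Fg|exact: Gg].
have [z gz <-] := Fonto q y q0 gy.
rewrite lieBl -FM [in lie (G x) _](FG q) // -GM (IH (p + q)) ?subrr //.
  by rewrite gtrDl.
exact: gr_lie.
Qed.

(** * Extension of a graded automorphism of m to its prolongation g(m) *)

Section ProlongHom.
Variables (K : fieldType) (m : finGlaType K) (M : glaType K).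
Variables (iota : {linear m -> M}) (psi psi' : {linear m -> m}).
Hypotheses (mF : is_fgla m) (iotaP : is_prolongation iota).
Hypotheses (psiP : is_gla_hom psi) (psi'P : is_gla_hom psi').
Hypotheses (psiK : cancel psi psi') (psi'K : cancel psi' psi).

(* The graph, degree by degree, of the extension of [psi] to [M]. *)
Inductive prolong_rel (p : int) (X Y : M) : Prop :=
| ProlongNeg u of p < 0 & gr p u & X = iota u & Y = iota (psi u)
| ProlongPos of 0 <= p & gr p X & gr p Y &
    (forall k u, k < 0 -> gr k u ->
       prolong_rel (p + k) (lie X (iota u)) (lie Y (iota (psi u)))).

Let fgla_nonneg p u : 0 <= p -> gr p u -> u = 0 :> m.
Proof. by case: mF => m0 _ _ /m0 ->. Qed.

Let iotaM u v : iota (lie u v) = lie (iota u) (iota v).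
Proof. by case: iotaP => [[_ ->]]. Qed.

Let iota_gr p u : gr p u -> gr p (iota u).
Proof.
case: (ltP p 0) => [p0|p0 /(fgla_nonneg p0) ->]; last by rewrite linear0; exact: gr0.
by move=> pu; case: iotaP => _ <- // _ _; exists u.
Qed.

Lemma prolong_rel_gr p X Y : prolong_rel p X Y -> gr p X /\ gr p Y.
Proof.
by case=> // u _ pu -> ->; split; apply: iota_gr => //; exact: (proj2 psiP).
Qed.

Lemma prolong_rel_iota p u : gr p u -> p < 0 -> prolong_rel p (iota u) (iota (psi u)).
Proof. by move=> pu p0; exact: (@ProlongNeg _ _ _ u). Qed.

Lemma prolong_rel_linear p a X Y X' Y' : prolong_rel p X Y ->
  prolong_rel p X' Y' -> prolong_rel p (a *: X + X') (a *: Y + Y').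
Proof.
elim/int_nonneg_ind: p a X Y X' Y' => [p IH p0|p p0] a X Y X' Y'.
  case=> [u|_ gX gY hX]; first by rewrite ltNge p0.
  case=> [u|_ gX' gY' hX']; first by rewrite ltNge p0.
  apply: ProlongPos => //; [exact: gr_linear|exact: gr_linear|].
  move=> k u k0 gu; rewrite !lie_linearl; apply: IH; [|exact: hX|exact: hX'].
  by rewrite gtrDl.
case=> [u _ gu -> ->|]; last by rewrite leNgt p0.
case=> [v _ gv -> ->|]; last by rewrite leNgt p0.
apply: (@ProlongNeg _ _ _ (a *: u + v)); rewrite ?linearP //; exact: gr_linear.
Qed.

Lemma prolong_rel00 p : prolong_rel p 0 0.
Proof.
elim/int_nonneg_ind: p => [p IH p0|p p0].
  apply: ProlongPos => //; [exact: gr0|exact: gr0|] => k u k0 _.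
  by rewrite !lie0x; apply: IH; rewrite gtrDl.
by have := prolong_rel_iota (gr0 p) p0; rewrite !linear0.
Qed.

(** By induction [Y] commutes with every [iota (psi u)] of negative degree; [psi] is onto, so
    transitivity gives 0. *)
Lemma prolong_rel0 p Y : prolong_rel p 0 Y -> Y = 0.
Proof.
case: iotaP => [[iI _] _ tM _].
elim/int_nonneg_ind: p Y => [p IH p0|p p0] Y; last first.
  case=> [u _ _ /esym/eqP|]; last by rewrite leNgt p0.
  by rewrite raddf_eq0 // => /eqP -> ->; rewrite !linear0.
case=> [u|_ _ gY h]; first by rewrite ltNge p0.
apply: (tM p) => // q y q0; case: (iotaP) => _ <- // _ _ [u gu <-].
apply: (IH (p + q)); first by rewrite gtrDl.
have := h q (psi' u) q0 (proj2 psi'P _ _ gu).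
by rewrite lie0x psi'K.
Qed.

Lemma prolong_rel_lieneg p k X Y u : k < 0 -> gr k u -> prolong_rel p X Y ->
  prolong_rel (p + k) (lie X (iota u)) (lie Y (iota (psi u))).
Proof.
move=> k0 gu [v p0 gv -> ->|_ _ _]; last exact.
rewrite -!iotaM -(proj1 psiP); apply: prolong_rel_iota; last by lia.
exact: gr_lie.
Qed.

Lemma prolong_rel_opp p X Y : prolong_rel p X Y -> prolong_rel p (- X) (- Y).
Proof.
by move=> h; have := prolong_rel_linear (-1) h (prolong_rel00 p);
  rewrite !scaleN1r !addr0.
Qed.

Lemma prolong_rel_sub p X Y X' Y' : prolong_rel p X Y -> prolong_rel p X' Y' ->
  prolong_rel p (X - X') (Y - Y').
Proof.
move=> h /prolong_rel_opp h'.
by have := prolong_rel_linear 1 h h'; rewrite !scale1r.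
Qed.

(** Induction on the total degree [p + q]: for nonnegative degrees, bracketing with a negative
    element and Jacobi give two brackets of smaller total degree. If one factor is negative the
    claim is nearly the definition. *)
Lemma prolong_rel_lie p q X Y X' Y' : prolong_rel p X Y -> prolong_rel q X' Y' ->
  prolong_rel (p + q) (lie X X') (lie Y Y').
Proof.
move: {2}(p + q) (erefl (p + q)) => r.
have negr p1 q1 A B A' B' : q1 < 0 -> prolong_rel p1 A B -> prolong_rel q1 A' B' ->
    prolong_rel (p1 + q1) (lie A A') (lie B B').
  move=> q0 hA; case=> [u _ gu -> ->|]; last by rewrite leNgt q0.
  exact: prolong_rel_lieneg.
have negl p1 q1 A B A' B' : p1 < 0 -> prolong_rel p1 A B -> prolong_rel q1 A' B' ->
    prolong_rel (p1 + q1) (lie A A') (lie B B').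
  move=> p0 hA hB; rewrite lieC [lie B B']lieC addrC; apply: prolong_rel_opp.
  exact: negr.
elim/int_nonneg_ind: r p q X Y X' Y' => [r IH r0|r r0] p q X Y X' Y' Er hX hX'.
  case: (ltP q 0) => [q0|q0]; first exact: negr.
  case: (ltP p 0) => [p0|p0]; first exact: negl.
  have [gX gY] := prolong_rel_gr hX; have [gX' gY'] := prolong_rel_gr hX'.
  apply: ProlongPos; [lia|exact: gr_lie|exact: gr_lie|] => k u k0 gu.
  rewrite !lie_lie; apply: prolong_rel_sub.
    by rewrite -addrA; apply: (IH (r + k)) => //; [lia|lia|exact: prolong_rel_lieneg].
  rewrite [p + q]addrC -addrA.
  by apply: (IH (r + k)) => //; [lia|lia|exact: prolong_rel_lieneg].
by case: (ltP q 0) => [q0|q0]; [exact: negr|apply: negl => //; lia].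
Qed.

(** In degree [p >= 0] the image [Y] has to act on [m] as the conjugate of the action of [X] by the
    extension already built in lower degrees. This conjugate [D] satisfies the Leibniz rule, so the
    universal property of g(m) realizes it by some [Y]. *)
Lemma prolong_rel_total p X : gr p X -> exists Y, prolong_rel p X Y.
Proof.
elim/int_nonneg_ind: p X => [p IH p0|p p0] X gX; last first.
  have [_ iota_im _ _] := iotaP.
  move: gX; rewrite -iota_im // => -[u gu <-].
  by exists (iota (psi u)); exact: prolong_rel_iota.
(* The graph of [D]: [w] is the image of the bracket of [X] with the preimage [psi' u]. *)
pose r k u w := gr k u /\ prolong_rel (p + k) (lie X (iota (psi' u))) w.
have rex k u : gr k u -> exists w, r k u w.
  move=> gu; case: (ltP k 0) => k0.
    have [||w hw] := IH (p + k) _ (lie X (iota (psi' u))); first by rewrite gtrDl.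
      by apply: gr_lie => //; apply: iota_gr; exact: (proj2 psi'P).
    by exists w.
  exists 0; split=> //; rewrite (fgla_nonneg k0 gu) !linear0 liex0.
  exact: prolong_rel00.
have [||||D DP] := @graded_extension _ m M r.
- exact: rex.
- by move=> k u w [].
- move=> k c u w u' w' [gu hw] [gu' hw']; split; first exact: gr_linear.
  by rewrite !linearP /= lie_linearr; exact: prolong_rel_linear.
- by move=> k w [_]; rewrite !linear0 liex0 => /prolong_rel0.
have rD k u : gr k u -> r k u (D u).
  by move=> gu; have [w hw] := rex _ _ gu; rewrite (DP _ _ _ hw).
have Dlie u v : D (lie u v) = lie (D u) (iota v) + lie (iota u) (D v).
  have [s [c [_ hc ->]]] := gr_span u; have [t [d [_ hd ->]]] := gr_span v.
  rewrite !lie_suml !linear_sum !lie_suml -big_split; apply: eq_bigr => k _ /=.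
  rewrite !lie_sumr linear_sum -big_split; apply: eq_bigr => l _ /=.
  move: (c k) (hc k) (d l) (hd l) => {c hc d hd} {}u gu {}v gv.
  case: (ltP k 0) => [k0|k0]; last first.
    by rewrite (fgla_nonneg k0 gu) !linear0 !lie0x !linear0 addr0.
  case: (ltP l 0) => [l0|l0]; last first.
    by rewrite (fgla_nonneg l0 gv) !linear0 !liex0 !linear0 addr0.
  apply: (DP (k + l)); split; first exact: gr_lie.
  rewrite (proj1 psi'P) iotaM.
  (* Jacobi splits the bracket into the two terms of the Leibniz rule; writing [u] and [v] as
     [psi (psi' u)] and [psi (psi' v)] matches each of them with the relation. *)
  have -> : lie X (lie (iota (psi' u)) (iota (psi' v))) =
     lie (lie X (iota (psi' u))) (iota (psi' v)) -
     lie (lie X (iota (psi' v))) (iota (psi' u)).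
    by rewrite (lie_lie X (iota (psi' u))) [X in _ - X]lieC opprK subrK.
  rewrite [lie (iota u) _]lieC; apply: prolong_rel_sub.
    rewrite addrA -{2}[v]psi'K; apply: prolong_rel_lieneg => //.
      exact: (proj2 psi'P).
    exact: (proj2 (rD _ _ gu)).
  rewrite [k + l]addrC addrA -{2}[u]psi'K; apply: prolong_rel_lieneg => //.
    exact: (proj2 psi'P).
  exact: (proj2 (rD _ _ gv)).
have [_ _ _ /(_ p D p0) []] := iotaP.
  by split=> // k u /rD[_ /prolong_rel_gr[]].
move=> Y gY DY; exists Y; apply: ProlongPos => // k u k0 gu.
rewrite -DY -{1}[u]psiK; apply: (proj2 (rD _ _ _)).
exact: (proj2 psiP).
Qed.

Lemma prolong_hom : exists2 Psi : {linear M -> M},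
  is_gla_hom Psi & forall u, Psi (iota u) = iota (psi u).
Proof.
have [||||F FP] := @graded_extension _ M M prolong_rel.
- exact: prolong_rel_total.
- by move=> p X Y /prolong_rel_gr[].
- exact: prolong_rel_linear.
- exact: prolong_rel0.
have rF p X : gr p X -> prolong_rel p X (F X).
  by move=> /prolong_rel_total[Y h]; rewrite (FP _ _ _ h).
exists F; [split|].
- move=> X Y.
  have [s [c [_ hc ->]]] := gr_span X; have [t [d [_ hd ->]]] := gr_span Y.
  rewrite !lie_suml !linear_sum lie_suml; apply: eq_bigr => k _ /=.
  rewrite !lie_sumr linear_sum; apply: eq_bigr => l _ /=.
  apply: (FP (k + l)); apply: prolong_rel_lie; exact: rF.
- by move=> p X /rF /prolong_rel_gr[].
- apply: (@gr_linear_ext _ m M (F \o iota) (iota \o psi)) => p u gu /=.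
  case: (ltP p 0) => p0; first exact: FP (prolong_rel_iota gu p0).
  by rewrite (fgla_nonneg p0 gu) !linear0.
Qed.

End ProlongHom.

(** * The prolongation of (m; e, f): uniqueness and extension of graded automorphisms *)

Section PseudoProductProlongationTheory.
Variables (K : fieldType) (m : finGlaType K) (M : glaType K).
Variables (iota : {linear m -> M}) (e f : {vspace m}).
Hypotheses (mF : is_fgla m) (iotaP : is_prolongation iota).

Local Notation g := (pp_prolongation iota e f).
Local Notation incl := (pp_incl iota e f).

Lemma pp_val_incl u : pp_val (incl u) = iota u.
Proof. exact: val_pp_incl. Qed.

Lemma pp_incl_linear : linear incl.
Proof.
move=> a u v; apply: val_inj; rewrite [RHS]/= ![LHS]pp_val_incl linearP.
by rewrite -!pp_val_incl.
Qed.

(** [pp_incl] carries a default value and is proved linear under [mF] and [iotaP], so its linear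
    structure is packed inside this section and made canonical locally. *)
Definition pp_incl_lin : {linear m -> g} :=
  HB.pack (pp_incl iota e f)
    (GRing.isLinear.Build K m g _ (pp_incl iota e f) pp_incl_linear).
#[local] Canonical pp_incl_lin.

Lemma pp_incl_inj : injective incl.
Proof.
move=> u v /(congr1 (fun x => pp_val x)); rewrite !pp_val_incl.
by case: iotaP => [[iI _] _ _ _]; exact: iI.
Qed.

Lemma pp_incl_lie u v : incl (lie u v) = lie (incl u) (incl v).
Proof.
apply: val_inj; rewrite [RHS]/= [LHS]pp_val_incl !pp_val_incl.
by case: iotaP => [[_ ->]].
Qed.

Lemma pp_incl_gr p u : gr p u -> gr p (incl u).
Proof.
case: (ltP p 0) => p0 gu; last first.
  by case: mF gu => /(_ p p0) -> _ _ ->; rewrite linear0; exact: gr0.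
apply: PPNeg; rewrite // pp_val_incl; case: iotaP => _ <- // _ _; exists u.
Qed.

Lemma pp_gr_neg p (x : g) : p < 0 -> gr p x -> exists2 u, gr p u & incl u = x.
Proof.
move=> p0 gx; have := pp_gr gx; case: iotaP => _ <- // _ _ [u gu ux].
by exists u => //; apply: val_inj; rewrite [LHS]pp_val_incl.
Qed.

Lemma pp_prolongation_transitive : transitive_gla g.
Proof.
move=> p x p0 gx x0; apply: val_inj; case: (iotaP) => _ iota_im tM _.
apply: (tM p) => //; first exact: pp_gr gx.
move=> q y q0; rewrite -iota_im // => -[u gu <-].
have := x0 q (incl u) q0 (pp_incl_gr gu).
by move=> /(congr1 (fun x => pp_val x)) /=; rewrite pp_val_incl.
Qed.

(** Degree -1 generates [m], so the two maps agree on the negative part; transitivity of the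
    prolongation does the rest. *)
Lemma pp_aut_ext (phi psi : GL g) : aut0 phi -> aut0 psi ->
  (forall u, gr (-1) u -> phi (incl u) = psi (incl u)) -> phi = psi.
Proof.
have homP (h : GL g) : aut0 h -> is_gla_hom h.
  by case=> hM hgr; split=> // p x gx; rewrite -hgr; exists x.
move=> /[dup] phi0 /homP phiP /homP psiP hE; apply: gl_ext.
have inclE : phi \o incl =1 psi \o incl.
  have compP (h : GL g) : is_gla_hom h -> is_gla_hom (h \o incl).
    case=> hM hgr; split=> [u v|p u gu] /=; first by rewrite pp_incl_lie hM.
    exact/hgr/pp_incl_gr.
  by apply: fgla_hom_ext => //; exact: compP.
apply: gla_hom_ext => //; first exact: pp_prolongation_transitive.
  move=> p x p0 gx; case: phi0 => _ /(_ p) E.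
  by move: gx; rewrite -{1}E => -[y gy <-]; exists y.
by move=> p x p0 /(pp_gr_neg p0)[u _ <-]; exact: inclE.
Qed.

(** In degree 0, [Psi X] acts on [m] as the conjugate of [X] by [psi], so it stabilizes [e] and [f]
    when [X] does. Positive degrees follow by induction, since each negative element is [Psi] of a
    negative one. *)
Lemma pp_piece_hom (psi psi' : {linear m -> m}) (Psi : {linear M -> M}) :
  is_gla_hom Psi -> (forall u, Psi (iota u) = iota (psi u)) ->
  is_gla_hom psi' -> cancel psi' psi ->
  (forall u, u \in e -> psi u \in e) -> (forall u, u \in e -> psi' u \in e) ->
  (forall u, u \in f -> psi u \in f) -> (forall u, u \in f -> psi' u \in f) ->
  forall p X, pp_piece iota e f p X -> pp_piece iota e f p (Psi X).
Proof.
move=> [PsiM Psig] PsiE [_ psi'g] psi'K ee ee' ff ff'.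
have stab (U : {vspace m}) X : (forall u, u \in U -> psi u \in U) ->
    (forall u, u \in U -> psi' u \in U) -> ad_stable iota X U -> ad_stable iota (Psi X) U.
  move=> UU UU' XU u /UU' /XU[v vU E]; exists (psi v); first exact: UU.
  by rewrite -{1}(psi'K u) -!PsiE -E PsiM.
elim/int_nonneg_ind => [p IH p0|p p0] X; last first.
  by move=> /pp_gr gX; apply: PPNeg => //; exact: Psig.
case=> [|p00 gX Xe Xf|p0' gX h]; first by rewrite ltNge p0.
  by apply: PPZero => //; [exact: Psig|exact: stab|exact: stab].
apply: PPPos => // [|k Y k0]; first exact: Psig.
case: (iotaP) => _ <- // _ _ [u gu <-].
rewrite -[u]psi'K -PsiE -PsiM; apply: IH; first by rewrite gtrDl.
apply: h => //; case: (iotaP) => _ <- // _ _.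
by exists (psi' u) => //; exact: psi'g.
Qed.

Lemma pp_extend (psi psi' : {linear m -> m}) :
  is_gla_hom psi -> is_gla_hom psi' -> cancel psi psi' -> cancel psi' psi ->
  (forall u, u \in e -> psi u \in e) -> (forall u, u \in e -> psi' u \in e) ->
  (forall u, u \in f -> psi u \in f) -> (forall u, u \in f -> psi' u \in f) ->
  exists2 Phi : {linear g -> g}, is_gla_hom Phi &
    forall u, Phi (incl u) = incl (psi u).
Proof.
move=> psiP psi'P psiK psi'K ee ee' ff ff'.
have [Psi PsiP PsiE] := prolong_hom mF iotaP psiP psi'P psiK psi'K.
have Psipp := pp_piece_hom PsiP PsiE psi'P psi'K ee ee' ff ff'.
have Psimem (x : g) : Psi (pp_val x) \in pp_mem iota e f.
  have /asboolP[s [c [us hc ->]]] := valP x.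
  rewrite linear_sum; apply: pp_mem_sum => p.
  by apply: (@pp_mem_piece _ _ _ _ _ _ p); exact: Psipp.
pose Phi x : g := PPProlongation (Psimem x).
have Phil : linear Phi by move=> a x y; apply: val_inj; rewrite /= linearP.
pose Phi' : {linear g -> g} := HB.pack Phi (GRing.isLinear.Build K g g _ Phi Phil).
exists Phi'; [split=> [x y|p x]|].
- by apply: val_inj; rewrite /= (proj1 PsiP).
- exact: Psipp.
- by move=> u; apply: val_inj; rewrite /= !pp_val_incl PsiE.
Qed.

(** Extend [psi] and [psi'] separately; both composites are the identity on the negative part, hence
    everywhere by [gla_hom_ext]. *)
Lemma pp_extend_aut (psi psi' : {linear m -> m}) :
  is_gla_hom psi -> is_gla_hom psi' -> cancel psi psi' -> cancel psi' psi ->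
  (forall u, u \in e -> psi u \in e) -> (forall u, u \in e -> psi' u \in e) ->
  (forall u, u \in f -> psi u \in f) -> (forall u, u \in f -> psi' u \in f) ->
  exists2 Phi : GL g, aut0_stab (pp_sub iota e f e) (pp_sub iota e f f) Phi &
    forall u, Phi (incl u) = incl (psi u).
Proof.
move=> psiP psi'P psiK psi'K ee ee' ff ff'.
have [F FP FE] := pp_extend psiP psi'P psiK psi'K ee ee' ff ff'.
have [G GP GE] := pp_extend psi'P psiP psi'K psiK ee' ee ff' ff.
have inv (F1 G1 : {linear g -> g}) (p1 q1 : {linear m -> m}) :
    is_gla_hom F1 -> is_gla_hom G1 -> cancel p1 q1 ->
    (forall u, F1 (incl u) = incl (p1 u)) -> (forall u, G1 (incl u) = incl (q1 u)) ->
    cancel F1 G1.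
  move=> [FM Fg] [GM Gg] pK F1E G1E.
  apply: (@gla_hom_ext _ g (G1 \o F1) idfun).
  - exact: pp_prolongation_transitive.
  - by split=> [x y|p x gx] /=; [rewrite FM GM|exact/Gg/Fg].
  - by [].
  - move=> p x p0 gx; exists x => //=.
    by have [u _ <-] := pp_gr_neg p0 gx; rewrite F1E G1E pK.
  - by move=> p x p0 /(pp_gr_neg p0)[u _ <-] /=; rewrite F1E G1E pK.
have FK : cancel F G by exact: (inv F G psi psi').
have GK : cancel G F by exact: (inv G F psi' psi).
pose Phi := MkGL (fun a x y => linearP F a x y) (Bijective FK GK).
have stab (U : {vspace m}) : (forall u, u \in U -> psi u \in U) ->
    (forall u, u \in U -> psi' u \in U) ->
    (Phi @` pp_sub iota e f U = pp_sub iota e f U)%classic.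
  move=> UU UU'; apply/seteqP; split=> [_ [_ [u uU <-] <-]|_ [u uU <-]].
    by exists (psi u); [exact: UU|rewrite /= FE].
  exists (incl (psi' u)); first by exists (psi' u) => //; exact: UU'.
  by rewrite /= FE psi'K.
exists Phi => //; split; [split|exact: stab|exact: stab].
  exact: (proj1 FP).
move=> p; apply/seteqP; split=> [_ [x gx <-]|x gx]; first exact: (proj2 FP).
by exists (G x); [exact: (proj2 GP)|exact: GK].
Qed.

End PseudoProductProlongationTheory.

(** * Freeness: the action of GL(e) x GL(f) on m *)

Lemma gr_scale (K : fieldType) (L : glaType K) p (a : K) (x : L) :
  gr p x -> gr p (a *: x).
Proof. by move=> gx; have := gr_linear a gx (gr0 p); rewrite addr0. Qed.

Lemma gr_sum (K : fieldType) (L : glaType K) p (I : Type) (s : seq I) (c : I -> L) :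
  (forall i, gr p (c i)) -> gr p (\sum_(i <- s) c i).
Proof.
move=> hc; elim/big_rec: _ => [|i x _ gx]; first exact: gr0.
by rewrite -[c i]scale1r; exact: gr_linear.
Qed.

Lemma gr_inter (K : fieldType) (L : glaType K) p q (x : L) :
  p != q -> gr p x -> gr q x -> x = 0.
Proof.
move=> pq px qx.
have us : uniq [:: p; q] by rewrite /= inE pq.
pose c r := if r == p then x else if r == q then - x else 0.
have hc r : gr r (c r).
  by rewrite /c; do 2?case: eqP => [->|_] //; [exact: gr_opp|exact: gr0].
have := gr_direct _ _ us hc _ p; rewrite big_cons big_seq1 inE /c !eqxx.
by rewrite [q == p]eq_sym (negPf pq) subrr; apply.
Qed.

Section FreePseudoProduct.
Variables (K : numFieldType) (m : finGlaType K).

(** The roles of [e] and [f] are symmetric, so a result about one factor transfers to the other. *)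
Lemma free_pseudo_productC (e f : {vspace m}) (a b mu : nat) :
  is_free_pseudo_product e f a b mu -> is_free_pseudo_product f e b a mu.
Proof.
have swap (m' : finGlaType K) (e' f' : {vspace m'}) :
    is_pseudo_product e' f' -> is_pseudo_product f' e'.
  case=> mF [[e0 f0] [g1 ef0] ee ff]; split=> //; split=> //.
  by rewrite addvC capvC.
case=> -[/swap fe km] mu2 [de df] univ; split=> // m' e' f' /swap fe' km' phi im he hf.
exact: (univ m' f' e').
Qed.

Variables (e f : {vspace m}) (a b mu : nat).
Hypothesis free : is_free_pseudo_product e f a b mu.

Let mF : is_fgla m. Proof. by case: free => -[[]]. Qed.
Let gr1 : (gr (-1) = [set x | x \in (e + f)%VS])%classic.
Proof. by case: free => -[[_ [_ [-> _]]]]. Qed.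
Let ef0 : (e :&: f)%VS = 0%VS. Proof. by case: free => -[[_ [_ [_ ->]]]]. Qed.
Let fe0 : (f :&: e)%VS = 0%VS. Proof. by rewrite capvC. Qed.

Lemma gr1_decomp x : gr (-1) x -> exists u v, [/\ u \in e, v \in f & x = u + v].
Proof. by rewrite gr1 => /memv_addP[u ue [v vf ->]]; exists u, v. Qed.

Lemma memv_gr1l x : x \in e -> gr (-1) x.
Proof. by rewrite gr1; exact: (subvP (addvSl e f)). Qed.

Lemma memv_gr1r x : x \in f -> gr (-1) x.
Proof. by rewrite gr1; exact: (subvP (addvSr e f)). Qed.

Lemma free_extend (A : {linear subvs_of e -> subvs_of e})
    (B : {linear subvs_of f -> subvs_of f}) : bijective A -> bijective B ->
  exists psi : {linear m -> m}, [/\ is_gla_hom psi,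
    forall u, psi (vsval u) = vsval (A u) & forall v, psi (vsval v) = vsval (B v)].
Proof.
move=> [A' AK A'K] [B' BK B'K].
(* The direct sum of [A] and [B] on [e + f], through the two projections. It is onto degree -1, so
   freeness applies with [m] as its own target. *)
pose phi u := vsval (A (vsproj e (daddv_pi e f u))) +
              vsval (B (vsproj f (daddv_pi f e u))).
have phil : linear phi by move=> c u v; rewrite /phi !linearP addrACA -scalerDr.
have [h hE] : exists h : 'Hom(m, m), forall u, h u = phi u.
  pose phi' : {linear m -> m} := HB.pack phi (GRing.isLinear.Build K m m _ phi phil).
  by exists (linfun phi') => u; rewrite lfunE.
have pi0 (U V : {vspace m}) u : (U :&: V)%VS = 0%VS -> (V :&: U)%VS = 0%VS ->
    u \in V -> daddv_pi U V u = 0.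
  move=> UV VU uV; have := daddv_pi_add UV (subvP (addvSr U V) u uV).
  by rewrite (daddv_pi_id VU uV) => /(canRL (addrK u)); rewrite subrr.
have phie (u : subvs_of e) : phi (vsval u) = vsval (A u).
  rewrite /phi daddv_pi_id ?subvsP // (pi0 f e) ?subvsP //.
  by rewrite vsvalK !linear0 addr0.
have phif (v : subvs_of f) : phi (vsval v) = vsval (B v).
  rewrite /phi [daddv_pi f e _]daddv_pi_id ?subvsP // (pi0 e f) ?subvsP //.
  by rewrite vsvalK !linear0 add0r.
have [[pp km] _ _ univ] := free.
have [|||psi [[[psiM psig _] psiE] _]] := univ m e f pp km h.
- apply/seteqP; split=> x /=.
    case=> u /gr1_decomp[v [w [ve wf ->]]] <-; rewrite linearD /= !hE.
    rewrite -(vsprojK ve) -(vsprojK wf) /= phie phif gr1.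
    exact: memv_add (subvsP _) (subvsP _).
  case/gr1_decomp => v [w [ve wf ->]].
  exists (vsval (A' (vsproj e v)) + vsval (B' (vsproj f w))).
    by rewrite gr1; exact: memv_add (subvsP _) (subvsP _).
  by rewrite linearD /= !hE phie phif A'K B'K !vsprojK.
- apply/subvP => _ /memv_imgP[u ue ->].
  by rewrite hE -(vsprojK ue) phie subvsP.
- apply/subvP => _ /memv_imgP[u uf ->].
  by rewrite hE -(vsprojK uf) phif subvsP.
exists psi; split; first by split.
- by move=> u; rewrite /= psiE ?hE //; apply/memv_gr1l/subvsP.
- by move=> v; rewrite /= psiE ?hE //; apply/memv_gr1r/subvsP.
Qed.

Lemma gla_hom_inv (psi psi' : {linear m -> m}) :
  is_gla_hom psi -> is_gla_hom psi' ->
  (forall u, u \in e -> psi' (psi u) = u) -> (forall u, u \in f -> psi' (psi u) = u) ->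
  cancel psi psi'.
Proof.
move=> [psiM psig] [psi'M psi'g] he hf.
apply: (@fgla_hom_ext _ m m (psi' \o psi) idfun mF).
- by split=> [x y|p x gx] /=; [rewrite psiM psi'M|exact/psi'g/psig].
- by [].
- by move=> x /gr1_decomp[u [v [ue vf ->]]] /=; rewrite !linearD he ?hf.
Qed.

Lemma free_extend_aut (A : GL (subvs_of e)) (B : GL (subvs_of f)) :
  exists psi psi' : {linear m -> m},
    [/\ is_gla_hom psi /\ is_gla_hom psi', cancel psi psi' /\ cancel psi' psi,
        forall u, psi (vsval u) = vsval (A u) /\ psi' (vsval u) = vsval ((A^-1)%g u)
      & forall v, psi (vsval v) = vsval (B v) /\ psi' (vsval v) = vsval ((B^-1)%g v)].
Proof.
have [psi [psiP psie psif]] := free_extend (gl_bij A) (gl_bij B).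
have [psi' [psi'P psi'e psi'f]] := free_extend (gl_bij (A^-1)%g) (gl_bij (B^-1)%g).
have AK u : (A^-1)%g (A u) = u := congr1 (fun h : GL _ => h u) (mulVg A).
have AK' u : A ((A^-1)%g u) = u := congr1 (fun h : GL _ => h u) (mulgV A).
have BK u : (B^-1)%g (B u) = u := congr1 (fun h : GL _ => h u) (mulVg B).
have BK' u : B ((B^-1)%g u) = u := congr1 (fun h : GL _ => h u) (mulgV B).
exists psi, psi'; split=> //; split; apply: gla_hom_inv => // u uU;
  rewrite -(vsprojK uU).
- by rewrite psie psi'e /= AK.
- by rewrite psif psi'f /= BK.
- by rewrite psi'e psie /= AK'.
- by rewrite psi'f psif /= BK'.
Qed.

Lemma dual_vector (V : vectType K) (y : V) : y != 0 ->
  exists al : {scalar V}, al y = 1.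
Proof.
move=> y0; exists (coord [tuple y] ord0).
by have := @coord_free _ _ _ [tuple y] ord0 ord0; apply; rewrite seq1_free.
Qed.

(** With a linear form [al] such that [al y = 1], the map [u + (c * al u) *: v] is invertible as
    soon as [1 + c * al v] is nonzero. The scalar [c] leaves room for [v = - y]. *)
Lemma transvection (V : vectType K) (y v : V) : y != 0 ->
  exists (A : GL V) (c : K), c != 0 /\ A y = y + c *: v.
Proof.
move=> y0; have [al aly] := dual_vector y0.
(* [c = 1] works unless [al v = -1], and then [c = 2] gives [1 + c * al v = -1]. *)
have [c c0 cv] : exists2 c : K, c != 0 & 1 + c * al v != 0.
  case: (eqVneq (1 + al v) 0) => [E|n0]; last by exists 1; rewrite ?oner_neq0 ?mul1r.
  exists 2%:R; first by rewrite pnatr_eq0.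
  rewrite mulr_natl mulr2n addrA E add0r.
  by move/eqP: E; rewrite addrC addr_eq0 => /eqP ->; rewrite oppr_eq0 oner_neq0.
pose A u := u + (c * al u) *: v.
(* The inverse has the same shape with parameter [d], the solution of [c + d + c * d * al v = 0]. *)
pose d := - (c / (1 + c * al v)).
pose A' u := u + (d * al u) *: v.
have Al : linear A.
  move=> k u w; rewrite /A linearP /= mulrDr mulrCA scalerDl scalerDr scalerA.
  by rewrite addrACA.
have cd : c + d + c * d * al v = 0.
  by rewrite /d; apply: (mulIf cv); rewrite mul0r; field.
have AK : cancel A A'.
  move=> u; rewrite /A /A' linearD linearZ /= -addrA -scalerDl.
  rewrite [X in X *: v](_ : _ = al u * (c + d + c * d * al v)); last by ring.
  by rewrite cd mulr0 scale0r addr0.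
have A'K : cancel A' A.
  move=> u; rewrite /A /A' linearD linearZ /= -addrA -scalerDl.
  rewrite [X in X *: v](_ : _ = al u * (c + d + c * d * al v)); last by ring.
  by rewrite cd mulr0 scale0r addr0.
exists (MkGL Al (Bijective AK A'K)), c; split=> //.
by rewrite /= /A aly mulr1.
Qed.

(** Extend the identity of [e] and a transvection [y |-> y + c v] of [f] to an automorphism of [m];
    applied to [lie x y = 0], it gives [c *: lie x v = 0]. *)
Lemma free_lie_annihilator x y : x \in e -> y \in f -> y != 0 ->
  lie x y = 0 -> forall v, v \in f -> lie x v = 0.
Proof.
move=> xe yf y0 xy v vf.
have [|A [c [c0 Ay]]] := @transvection _ (vsproj f y) (vsproj f v).
  by apply: contraNneq y0 => /(congr1 vsval); rewrite vsprojK // linear0 => ->.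
have [psi [psi' [[[psiM _] _] _ psie psif]]] := free_extend_aut 1%g A.
have := psiM x y; rewrite xy linear0 -{1}(vsprojK xe) -{1}(vsprojK yf).
rewrite (proj1 (psie _)) (proj1 (psif _)) Ay linearD linearZ /= !vsprojK //.
rewrite lieDr xy add0r => /esym E.
have := lie_linearr c v 0 x; rewrite !addr0 liex0 addr0 E => /esym /eqP.
by rewrite scaler_eq0 (negPf c0) => /eqP.
Qed.

End FreePseudoProduct.

(** * Nondegeneracy of the bracket on e x f, and the derivation equal to 1 on e and 0 on f *)

Lemma interpolation (F : fieldType) (x y : nat -> F) (n : nat) : injective x ->
  exists P : {poly F}, forall i, (i < n)%N -> P.[x i] = y i.
Proof.
move=> xI; elim: n => [|n [P PE]]; first by exists 0.
(* Newton's correction term: [Q] vanishes at the earlier nodes but not at [x n]. *)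
pose Q := \prod_(j < n) ('X - (x j)%:P).
have Q0 : Q.[x n] != 0.
  rewrite horner_prod prodf_seq_neq0; apply/allP => j _ /=.
  by rewrite hornerXsubC subr_eq0 (inj_eq xI) gtn_eqF.
exists (P + ((y n - P.[x n]) / Q.[x n]) *: Q) => i; rewrite ltnS hornerD hornerZ.
rewrite leq_eqVlt => /orP[/eqP ->|ltin]; first by rewrite divfK // addrC subrK.
have -> : Q.[x i] = 0; last by rewrite mulr0 addr0 PE.
rewrite horner_prod (bigD1 (Ordinal ltin)) //= hornerXsubC subrr.
by rewrite mul0r.
Qed.

Section FreePseudoProductDerivation.
Variables (K : numFieldType) (m : finGlaType K) (e f : {vspace m}) (a b mu : nat).
Hypothesis free : is_free_pseudo_product e f a b mu.

Let mF : is_fgla m. Proof. by case: free => -[[]]. Qed.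
Let ee u v : u \in e -> v \in e -> lie u v = 0.
Proof. by case: free => -[[_ [_ _ h _]] _] _ _ _; exact: h. Qed.
Let ff u v : u \in f -> v \in f -> lie u v = 0.
Proof. by case: free => -[[_ [_ _ _ h]] _] _ _ _; exact: h. Qed.

Lemma free_lie_neq0 x y : x \in e -> y \in f -> x != 0 -> y != 0 -> lie x y != 0.
Proof.
move=> xe yf x0 y0; apply/eqP => xy.
(* The annihilator argument runs twice: [x] kills all of [f]; then each [u] in [f] kills the nonzero
   [x], hence all of [e]. *)
have fe u v : u \in f -> v \in e -> lie u v = 0.
  move=> uf; apply: (free_lie_annihilator (free_pseudo_productC free) uf xe x0).
  by rewrite lieC (free_lie_annihilator free xe yf y0 xy uf) oppr0.
(* Now degree -1 is closed under the bracket, so it is all of [m], against a nonzero component of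
   degree [- mu] with [mu >= 2]. *)
have gr1 (u : m) : gr (-1) u.
  move: u; apply: (fgla_ind mF) => [//|c u v|u v]; first exact: gr_linear.
  move=> /(gr1_decomp free)[u1 [u2 [u1e u2f ->]]].
  move=> /(gr1_decomp free)[v1 [v2 [v1e v2f ->]]].
  rewrite lieDl !lieDr [lie u1 v2]lieC (ee u1e v1e) (ff u2f v2f) !fe // oppr0 !addr0.
  exact: gr0.
case: free => -[_ [km _]] mu2 _ _; apply: km; apply/seteqP; split=> [u gu|_ ->] /=.
  by apply: (gr_inter _ gu (gr1 u)); apply/eqP; lia.
exact: gr0.
Qed.

(** For an iterated bracket of [p] elements of [e] and [f], [h] counts those taken from [e]. The
    bound [h <= p] confines the eigenvalues that occur to finitely many nodes. *)
Definition bieigen (psi : {linear m -> m}) (p h : nat) (u : m) : Prop :=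
  [/\ gr (- p%:Z) u, psi u = 2%:R ^+ h *: u & (h <= p)%N].

Section Bigrading.
Variable psi : {linear m -> m}.
Hypotheses (psiP : is_gla_hom psi) (psie : forall u, u \in e -> psi u = 2%:R *: u).
Hypothesis psif : forall u, u \in f -> psi u = u.

Lemma bieigen_e u : u \in e -> bieigen psi 1 1 u.
Proof. by move=> ue; split=> //; [exact: (memv_gr1l free)|exact: psie]. Qed.

Lemma bieigen_f u : u \in f -> bieigen psi 1 0 u.
Proof.
by move=> uf; split=> //; [exact: (memv_gr1r free)|rewrite psif ?scale1r].
Qed.

Lemma bieigen_lie p h u q k v :
  bieigen psi p h u -> bieigen psi q k v -> bieigen psi (p + q) (h + k) (lie u v).
Proof.
move=> [gu pu hp] [gv pv kq]; split; last exact: leq_add.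
  by rewrite PoszD opprD; exact: gr_lie.
rewrite (proj1 psiP) pu pv exprD.
have := lie_linearl (2%:R ^+ h) u 0 (2%:R ^+ k *: v); rewrite lie0x !addr0 => ->.
have := lie_linearr (2%:R ^+ k) v 0 u; rewrite liex0 !addr0 => ->.
by rewrite scalerA.
Qed.

(** Elements of [e] and [f] are eigenvectors and brackets of eigenvectors are eigenvectors, so
    [fgla_ind] applies. *)
Lemma bieigen_span u : exists l : seq (nat * nat * m),
  (forall i, i \in l -> bieigen psi i.1.1 i.1.2 i.2) /\ u = \sum_(i <- l) i.2.
Proof.
move: u; apply: (fgla_ind mF) =>
  [u|c _ _ [l [hl ->]] [l' [hl' ->]]|_ _ [l [hl ->]] [l' [hl' ->]]].
- move=> /(gr1_decomp free)[v [w [ve wf ->]]].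
  exists [:: (1, 1, v); (1, 0, w)]%N; rewrite big_cons big_seq1; split=> // i.
  by rewrite !inE => /orP[|] /eqP -> /=; [exact: bieigen_e|exact: bieigen_f].
- exists ([seq (i.1, c *: i.2) | i <- l] ++ l').
  rewrite big_cat big_map /= scaler_sumr; split=> // i.
  rewrite mem_cat => /orP[/mapP[j /hl [gj pj hj] ->]|/hl' //]; split=> //=.
    exact: gr_scale.
  by rewrite linearZ /= pj !scalerA mulrC.
- exists [seq (i.1.1 + j.1.1, i.1.2 + j.1.2, lie i.2 j.2)%N | i <- l, j <- l'].
  split.
    move=> _ /allpairsP[[i j] [/= /hl hi /hl' hj ->]] /=.
    exact: bieigen_lie.
  rewrite big_allpairs_dep /= lie_suml; apply: eq_bigr => i _.
  by rewrite lie_sumr.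
Qed.

(* An eigenvalue [2 ^ h] of [psi] marks the part of bidegree [h] in [e]; a
   polynomial in [psi] turns [2 ^ h] into [h], whence an additive grading. *)
Lemma bigrading_derivation : exists D : {linear m -> m},
  [/\ forall p u, gr p u -> gr p (D u),
      forall u v, D (lie u v) = lie (D u) v + lie u (D v),
      forall u, u \in e -> D u = u & forall u, u \in f -> D u = 0].
Proof.
(* The nodes are [2 ^ h] for [0 <= h <= mu], hence [mu.+1] of them; they are distinct in
   characteristic 0. The derivation sought is [P] evaluated at [psi]. *)
have [|P PE] := @interpolation K (fun h => 2%:R ^+ h) (fun h => h%:R) mu.+1.
  by apply: ieexprIn; rewrite ?ltr0n // pnatr_eq1.
pose D u := \sum_(j < size P) P`_j *: iter j psi u.
have Dl : linear D.
  move=> c u v; rewrite /D scaler_sumr -big_split; apply: eq_bigr => j _ /=.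
  rewrite (_ : iter j psi _ = c *: iter j psi u + iter j psi v).
    by rewrite scalerDr !scalerA mulrC.
  by elim: {j}(j : nat) => //= j ->; rewrite linearP.
have [h hE] : exists h : {linear m -> m}, forall u, h u = D u.
  pose h : {linear m -> m} := HB.pack D (GRing.isLinear.Build K m m _ D Dl).
  by exists h.
have hB p k u : bieigen psi p k u -> h u = k%:R *: u.
  (* For [p > mu] the component of degree [- p] is zero; otherwise [k <= p <= mu], so [2 ^ k] is a
     node of the interpolation. *)
  move=> [gu pu kp]; have [pmu|mup] := leqP p mu; last first.
    have [[_ [_ low]] _ _ _] := free.
    move: gu; rewrite low ?ltrN2 ?ltz_nat // => ->.
    by rewrite linear0 scaler0.
  rewrite hE -PE ?ltnS ?(leq_trans kp) // horner_coef scaler_suml.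
  apply: eq_bigr => j _; rewrite -scalerA; congr (_ *: _).
  elim: {j}(j : nat) => [|j IH]; first by rewrite expr0 scale1r.
  by rewrite iterS IH linearZ /= pu scalerA exprSr.
exists h; split.
- move=> p u gu; rewrite hE; apply: gr_sum => j; apply: gr_scale.
  by elim: {j}(j : nat) => //= j; exact: (proj2 psiP).
(* On eigenvectors of exponents [h] and [k] the Leibniz rule is [(h + k) = h + k], because exponents
   add under the bracket. *)
- move=> u v; have [l [hl ->]] := bieigen_span u; have [l' [hl' ->]] := bieigen_span v.
  rewrite !lie_suml !linear_sum !lie_suml -big_split big_seq [RHS]big_seq.
  apply: eq_bigr => i /hl hi /=.
  rewrite !lie_sumr !linear_sum -big_split big_seq [RHS]big_seq.
  apply: eq_bigr => j /hl' hj /=.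
  rewrite (hB _ _ _ (bieigen_lie hi hj)) (hB _ _ _ hi) (hB _ _ _ hj).
  rewrite natrD scalerDl; congr (_ + _).
    by have := lie_linearl i.1.2%:R i.2 0 j.2; rewrite lie0x !addr0 => ->.
  by have := lie_linearr j.1.2%:R j.2 0 i.2; rewrite liex0 !addr0 => ->.
- by move=> u /bieigen_e /hB ->; rewrite scale1r.
- by move=> u /bieigen_f /hB ->; rewrite scale0r.
Qed.

End Bigrading.

Lemma free_derivation : exists D : {linear m -> m},
  [/\ forall p u, gr p u -> gr p (D u),
      forall u v, D (lie u v) = lie (D u) v + lie u (D v),
      forall u, u \in e -> D u = u & forall u, u \in f -> D u = 0].
Proof.
have n2 : 2%:R != 0 :> K by rewrite pnatr_eq0.
(* The automorphism of [m] extending multiplication by 2 on [e] and the identity on [f]. *)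
have [psi [psiP psie psif]] := @free_extend _ _ _ _ _ _ _ free ( *:%R 2%:R) idfun
  (Bijective (scalerK n2) (scalerKV n2)) (Bijective (fun=> erefl) (fun=> erefl)).
apply: (@bigrading_derivation psi psiP) => u uU; rewrite -(vsprojK uU).
  by rewrite psie linearZ.
by rewrite psif.
Qed.

End FreePseudoProductDerivation.

(** * The isomorphism with GL(e) x GL(f), and the case of unequal dimensions *)

Section FreeProlongation.
Variables (K : numFieldType) (m : finGlaType K) (M : glaType K).
Variables (iota : {linear m -> M}) (e f : {vspace m}) (a b mu : nat).
Hypotheses (free : is_free_pseudo_product e f a b mu).
Hypothesis (iotaP : is_prolongation iota).

Local Notation g := (pp_prolongation iota e f).
Local Notation incl := (pp_incl iota e f).
Local Notation sub := (pp_sub iota e f).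

Let mF : is_fgla m. Proof. by case: free => -[[]]. Qed.

Let incl_lin : {linear m -> g} := pp_incl_lin e f mF iotaP.
#[local] Canonical incl_lin.
Let inclI : injective incl := pp_incl_inj mF iotaP.

(** The restriction is read off from its graph through the injective [incl]; the same construction
    for the inverse of [phi] shows that it is invertible. *)
Lemma aut0_restrict (U : {vspace m}) (phi : GL g) : (phi @` sub U = sub U)%classic ->
  exists h : GL (subvs_of U),
    forall u, phi (incl (vsval u)) = incl (vsval (h u)).
Proof.
have lin (psi : GL g) : (psi @` sub U = sub U)%classic ->
    exists F : {linear subvs_of U -> subvs_of U},
      forall u, psi (incl (vsval u)) = incl (vsval (F u)).
  move=> psiU.
  have [|||F FE] := @linear_relation_fun K (subvs_of U) (subvs_of U)
    (fun u w => psi (incl (vsval u)) = incl (vsval w)).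
  - move=> u; have : (psi @` sub U)%classic (psi (incl (vsval u))).
      by exists (incl (vsval u)) => //; exists (vsval u) => //; exact: subvsP.
    by rewrite psiU => -[w wU <-]; exists (vsproj U w); rewrite vsprojK.
  - by move=> c x y x' y' E E'; rewrite !linearP /= E E'.
  - move=> y; rewrite !linear0 => /esym E; apply: subvs_inj; apply: inclI.
    by rewrite E !linear0.
  by exists F => u; apply/FE.
move=> phiU; have [F FE] := lin phi phiU; have [G GE] := lin _ (gl_image_inv phiU).
have FK : cancel F G.
  by move=> u; apply: subvs_inj; apply: inclI; rewrite -GE -FE glVK.
have GK : cancel G F.
  by move=> u; apply: subvs_inj; apply: inclI; rewrite -FE -GE glKV.
by exists (MkGL (fun c x y => linearP F c x y) (Bijective FK GK)).
Qed.

Lemma aut0_restrict_mul :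
  exists Phi : {multiplicative aut0_group (sub e) (sub f) ->
                  (GL (subvs_of e) * GL (subvs_of f))%type},
  bijective Phi /\
  forall phi : aut0_group (sub e) (sub f),
    (forall u : subvs_of e,
       phi (incl (vsval u)) = incl (vsval ((Phi phi).1 u))) /\
    (forall v : subvs_of f,
       phi (incl (vsval v)) = incl (vsval ((Phi phi).2 v))).
Proof.
have [Phi PhiE] : {Phi : aut0_group (sub e) (sub f) -> GL (subvs_of e) * GL (subvs_of f) &
    forall phi : aut0_group (sub e) (sub f),
                (forall u, phi (incl (vsval u)) = incl (vsval ((Phi phi).1 u))) /\
                (forall v, phi (incl (vsval v)) = incl (vsval ((Phi phi).2 v)))}.
  apply: (@choice _ _ (fun (phi : aut0_group (sub e) (sub f))
      (h : GL (subvs_of e) * GL (subvs_of f)) =>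
    (forall u, phi (incl (vsval u)) = incl (vsval (h.1 u))) /\
    (forall v, phi (incl (vsval v)) = incl (vsval (h.2 v))))) => phi.
  have /set_mem[_ phie phif] := valP phi.
  have [A AE] := aut0_restrict phie; have [B BE] := aut0_restrict phif.
  by exists (A, B).
(* A pair that describes [phi] on [e] and [f] is [Phi phi]; this gives both multiplicativity and
   surjectivity. *)
have Phi_uniq (phi : aut0_group (sub e) (sub f))
  (h : GL (subvs_of e) * GL (subvs_of f)) :
    (forall u, phi (incl (vsval u)) = incl (vsval (h.1 u))) ->
    (forall v, phi (incl (vsval v)) = incl (vsval (h.2 v))) -> Phi phi = h.
  case: h => A B /= AE BE; rewrite [LHS]surjective_pairing; congr (_, _).
    by apply: gl_ext => u; apply: subvs_inj; apply: inclI; rewrite -AE -(proj1 (PhiE _)).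
  by apply: gl_ext => u; apply: subvs_inj; apply: inclI; rewrite -BE -(proj2 (PhiE _)).
have PhiM : {morph Phi : phi psi / (phi * psi)%g}.
  move=> phi psi; apply: Phi_uniq => u /=.
    by rewrite -(proj1 (PhiE phi)) -(proj1 (PhiE psi)).
  by rewrite -(proj2 (PhiE phi)) -(proj2 (PhiE psi)).
pose PhiL : {multiplicative aut0_group (sub e) (sub f) ->
    (GL (subvs_of e) * GL (subvs_of f))%type} :=
  HB.pack Phi (isMultiplicative.Build _ _ Phi PhiM).
exists PhiL; split=> //.
(* Injectivity: [e + f] is all of degree -1, which determines a graded automorphism. *)
have PhiI phi psi : Phi phi = Phi psi -> phi = psi.
  move=> E; apply: val_inj => /=.
  have /set_mem[phi0 _ _] := valP phi; have /set_mem[psi0 _ _] := valP psi.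
  apply: (pp_aut_ext mF iotaP phi0 psi0) => w /(gr1_decomp free)[u [v [ue vf ->]]].
  have [phie phif] := PhiE phi; have [psie psif] := PhiE psi.
  rewrite !linearD /= -(vsprojK ue) -(vsprojK vf); congr (_ + _).
    by rewrite [LHS]phie [RHS]psie E.
  by rewrite [LHS]phif [RHS]psif E.
(* Surjectivity: freeness extends the pair to [m], then prolongation extends it to [g]. *)
have [|G GK] := @choice _ _ (fun h phi => Phi phi = h).
  move=> [A B].
  have [psi [psi' [[psiP psi'P] [psiK psi'K] psie psif]]] := free_extend_aut free A B.
  have [u uU|u uU|u uU|u uU|phi phiP phiE] :=
    pp_extend_aut (e := e) (f := f) mF iotaP psiP psi'P psiK psi'K.
  - by rewrite -(vsprojK uU) (proj1 (psie _)) subvsP.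
  - by rewrite -(vsprojK uU) (proj2 (psie _)) subvsP.
  - by rewrite -(vsprojK uU) (proj1 (psif _)) subvsP.
  - by rewrite -(vsprojK uU) (proj2 (psif _)) subvsP.
  exists (MkAut0 (mem_set phiP)); apply: Phi_uniq => u /=; rewrite phiE.
    by rewrite (proj1 (psie _)).
  by rewrite (proj1 (psif _)).
by exists G => // phi; apply: PhiI; rewrite GK.
Qed.

(* [D] projects [e + f] onto [e], so [U] contains the components in [e] and [f]
   of its elements, and these components commute. *)
Lemma free_stable_abelian (D : {linear m -> m}) (U : {vspace m}) :
  (forall u, u \in e -> D u = u) -> (forall u, u \in f -> D u = 0) ->
  (forall u, u \in U -> gr (-1) u) -> (forall u, u \in U -> D u \in U) ->
  (forall u v, u \in U -> v \in U -> lie u v = 0) -> (U <= e)%VS \/ (U <= f)%VS.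
Proof.
move=> De Df U1 UD UU.
case: (boolP (U <= e)%VS) => [|/subvPn[u uU ue]]; [by left|right].
apply: contraNT ue => /subvPn[v vU vf].
have [u1 [u2 [u1e u2f uE]]] := gr1_decomp free (U1 _ uU).
have [v1 [v2 [v1e v2f vE]]] := gr1_decomp free (U1 _ vU).
(* [v1] is [D v] and [u2] is [u - D u]; were both nonzero, their vanishing bracket would contradict
   nondegeneracy. *)
have v1U : v1 \in U by have := UD v vU; rewrite vE linearD De // Df // addr0.
have u2U : u2 \in U.
  have := UD u uU; rewrite {1}uE linearD De // Df // addr0 => u1U.
  by have := memvB uU u1U; rewrite uE addrAC subrr add0r.
case: (eqVneq u2 0) => [u20|u20]; first by rewrite uE u20 addr0.
case: (eqVneq v1 0) => [v10|v10]; first by rewrite vE v10 add0r v2f in vf.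
by have /eqP[] := free_lie_neq0 free v1e u2f v10 u20; exact: UU.
Qed.

(** [phi] preserves the negative part, which is the image of [incl]; carried back to the
    finite-dimensional [m], it can be studied by counting dimensions. *)
Lemma aut0_induced (phi : GL g) : aut0 phi ->
  exists rho : 'End(m), [/\ lker rho == 0%VS,
    forall u, phi (incl u) = incl (rho u), forall x y, rho (lie x y) = lie (rho x) (rho y)
    & forall u, gr (-1) u -> gr (-1) (rho u)].
Proof.
move=> [phiM phig].
have phi_gr p x : gr p x -> gr p (phi x) by move=> gx; rewrite -phig; exists x.
have [|||rho rhoE] := @linear_relation_fun K m m (fun u w => phi (incl u) = incl w).
- move=> u; have [s [c [_ hc ->]]] := gr_span u.
  have [d dE] : {d : int -> m & forall p, phi (incl (c p)) = incl (d p)}.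
    apply: (@choice _ _ (fun p w => phi (incl (c p)) = incl w)) => p.
    case: (ltP p 0) => p0; last first.
      exists 0; have [/(_ p p0) m0 _ _] := mF; have := hc p; rewrite m0 => ->.
      by rewrite !linear0.
    have [w _ <-] := pp_gr_neg mF iotaP p0 (phi_gr p _ (pp_incl_gr e f mF iotaP (hc p))).
    by exists w.
  by exists (\sum_(p <- s) d p); rewrite !linear_sum; apply: eq_bigr => p _; exact: dE.
- by move=> c x y x' y' E E'; rewrite !linearP /= E E'.
- by move=> y; rewrite !linear0 => E; apply: inclI; rewrite linear0.
have rhoE' u : phi (incl u) = incl (linfun rho u) by apply/rhoE; rewrite lfunE.
exists (linfun rho); split=> //.
- apply/lker0P => u v E; apply: inclI; apply: (can_inj (glVK phi)).
  by rewrite !rhoE' E.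
- move=> x y; apply: inclI.
  by rewrite -rhoE' !(pp_incl_lie e f mF iotaP) phiM !rhoE'.
- move=> u gu; have := phi_gr _ _ (pp_incl_gr e f mF iotaP gu).
  rewrite rhoE' => /(pp_gr_neg mF iotaP (ltrN10 _))[w gw /inclI <-] //.
Qed.

Lemma aut0_stabE : \dim e <> \dim f -> aut0_stab (sub e) (sub f) = @aut0 K g.
Proof.
move=> def; apply/seteqP; split=> [phi []//|phi phi0].
have [rho [rhoI rhoE rhoM rho1]] := aut0_induced phi0.
have [D [Dg DM De Df]] := free_derivation free.
(* A derivation of degree 0 is a prolongation map, so [D] is the action of an element of degree 0;
   below it stabilizes [e] and [f] and thus lies in [g]. *)
have [X gX XE] : exists2 X, gr 0 X & forall u, iota (D u) = lie X (iota u).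
  have [[_ iotaM] iota_im _ univ] := iotaP.
  have [|X gX XE] := univ 0 (iota \o D : {linear m -> M}) (lexx _); last by exists X.
  split=> [p u gu|u v] /=; last by rewrite DM linearD /= !iotaM.
  have /pp_gr := pp_incl_gr e f mF iotaP (Dg _ _ gu).
  by rewrite pp_val_incl // add0r.
have ppX : pp_piece iota e f 0 X.
  apply: PPZero => // u uU; exists (D u); rewrite -?XE //.
    by rewrite De.
  by rewrite Df // mem0v.
pose x : g := PPProlongation (pp_mem_piece ppX).
have xE u : lie x (incl u) = incl (D u).
  by apply: val_inj; rewrite /= !pp_val_incl.
have gx : gr 0 ((phi^-1)%g x).
  have [_ /(_ 0) E] := phi0; rewrite -(gl_image_inv E); exists x => //.
(* Conjugation: [D] acts on [rho @: U] as the preimage of [x] under [phi] acts on [U]. That preimage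
   has degree 0 in [g], so it stabilizes [e] and [f]. *)
have stab (U : {vspace m}) : ad_stable iota (pp_val ((phi^-1)%g x)) U ->
    forall u, u \in (rho @: U)%VS -> D u \in (rho @: U)%VS.
  move=> xU _ /memv_imgP[u uU ->]; have [v vU vE] := xU u uU.
  suff -> : D (rho u) = rho v by exact: memv_img.
  apply: inclI; rewrite -xE -!rhoE -[x](glKV phi) -(proj1 phi0); congr (phi _).
  by apply: val_inj; rewrite /= !pp_val_incl.
have [xe xf] : ad_stable iota (pp_val ((phi^-1)%g x)) e /\
               ad_stable iota (pp_val ((phi^-1)%g x)) f.
  by case: gx; rewrite ?ltxx.
have [[[_ [[e0 f0] [g1 ef0] ee ff]] _] _ _ _] := free.
have inS (U : {vspace m}) : (forall u, u \in U -> gr (-1) u) ->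
    (forall u v, u \in U -> v \in U -> lie u v = 0) ->
    ad_stable iota (pp_val ((phi^-1)%g x)) U ->
    (rho @: U <= e)%VS \/ (rho @: U <= f)%VS.
  move=> U1 UU xU; apply: (free_stable_abelian De Df _ (stab U xU)).
    by move=> _ /memv_imgP[u uU ->]; exact/rho1/U1.
  move=> _ _ /memv_imgP[u uU ->] /memv_imgP[v vU ->].
  by rewrite -rhoM UU // linear0.
have dimrho U : \dim (rho @: U) = \dim U.
  by apply: limg_dim_eq; rewrite (eqP rhoI) capv0.
(* If both images lay in [V], injectivity of [rho] would give [dim V + dim W <= dim V] with [W]
   nonzero. *)
have notboth (V W : {vspace m}) : (V :&: W)%VS = 0%VS -> W != 0%VS ->
    \dim (V + W) = \dim (e + f) -> ~ ((rho @: e <= V)%VS /\ (rho @: f <= V)%VS).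
  move=> VW W0 d [he hf].
  have : (\dim (rho @: (e + f)) <= \dim V)%N 
    by rewrite limgD dimvS // subv_add he.
  rewrite dimrho -d dimv_disjoint_sum // -{2}[\dim V]addn0 leq_add2l leqn0.
  by rewrite dimv_eq0 (negPf W0).
have image (U : {vspace m}) : (rho @: U <= U)%VS -> (phi @` sub U = sub U)%classic.
  move=> UU; have UE : (rho @: U = U)%VS by apply/eqP; rewrite eqEdim UU dimrho leqnn.
  apply/seteqP; split=> [_ [_ [u uU <-] <-]|_ [u uU <-]].
    by exists (rho u); rewrite ?rhoE //=; apply: (subvP UU); exact: memv_img.
  have /memv_imgP[v vU uE] : u \in (rho @: U)%VS by rewrite UE.
  by exists (incl v); [exists v|rewrite rhoE uE].
(* Of the four cases, two are excluded by [notboth]; the exchange of [e] and [f] would force equal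
   dimensions. *)
have [he|he] := inS e (memv_gr1l free) ee xe;
  have [hf|hf] := inS f (memv_gr1r free) ff xf.
- by case: (notboth e f ef0 f0 erefl (conj he hf)).
- by split=> //; exact: image.
- case: def; apply/eqP; rewrite eqn_leq -{1}(dimrho e) -{2}(dimrho f).
  by rewrite !dimvS.
- have fe0 : (f :&: e)%VS = 0%VS by rewrite capvC.
  by case: (notboth f e fe0 e0 _ (conj he hf)); rewrite addvC.
Qed.

End FreeProlongation.

Theorem theorem9p2 (R : realType) (m : finGlaType R[i]) (e f : {vspace m})
    (a b mu : nat) (M : glaType R[i]) (iota : {linear m -> M}) :
  is_free_pseudo_product e f a b mu ->
  is_prolongation iota ->
  let g : glaType R[i] := pp_prolongation iota e f in
  let E : set g := pp_sub iota e f e in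
  let F : set g := pp_sub iota e f f in
  (exists Phi : {multiplicative aut0_group E F ->
                   (GL (subvs_of e) * GL (subvs_of f))%type},
     bijective Phi /\
     forall phi : aut0_group E F,
       (forall u : subvs_of e,
          phi (pp_incl iota e f (vsval u)) =
          pp_incl iota e f (vsval ((Phi phi).1 u))) /\
       (forall v : subvs_of f,
          phi (pp_incl iota e f (vsval v)) =
          pp_incl iota e f (vsval ((Phi phi).2 v)))) /\
  (\dim e <> \dim f -> aut0_stab E F = @aut0 R[i] g).
Proof.
move=> free iotaP; split; last exact: (aut0_stabE free iotaP).
exact: (aut0_restrict_mul free iotaP).
Qed.
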